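(* Every primitive ideal of $\ell^1(\Sigma)$ is selfadjoint.
   Context: $X$ is a non-empty compact Hausdorff space, $\sigma:X\to X$ is a homeomorphism, and $\Sigma=(X,\sigma)$. $C(X)$ is the algebra of continuous complex-valued functions with the supremum norm, and $\alpha(f)=f\circ\sigma^{-1}$ for $f\in C(X)$. $\ell^1(\Sigma)$ is the Banach space of all $a:\mathbb{Z}\to C(X)$ with $\|a\|=\sum_n\|a(n)\|<\infty$, with multiplication $(aa')(n)=\sum_{k\in\mathbb{Z}}a(k)\,\alpha^k(a'(n-k))$ and isometric involution $a^*(n)=\overline{\alpha^n(a(-n))}$; it is a unital Banach $*$-algebra. A representation $\pi$ of an algebra $A$ on a complex vector space $E$ (a homomorphism into the linear operators on $E$; no topology on $E$) is algebraically irreducible if $\pi(A)E\neq\{0\}$ and the only invariant subspaces are $\{0\}$ and $E$. A primitive ideal is the kernel of an algebraically irreducible representation. An ideal $I$ is selfadjoint if $I^*=I$. *)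

(* Defs.v *)
From HB Require Import structures.
From mathcomp Require Import all_boot all_order all_algebra.
From mathcomp Require Import finmap all_classical all_reals.
From mathcomp Require Import topology normedtype ereal esum.
From mathcomp Require Import complex ring.
From mathcomp Require summability.
Set Implicit Arguments.
Unset Strict Implicit.
Unset Printing Implicit Defensive.
Import Order.TTheory GRing.Theory Num.Theory numFieldNormedType.Exports.
Import ComplexField.Normc.
Local Open Scope classical_set_scope.
Local Open Scope ring_scope.
Local Open Scope complex_scope.

(* The norm topology, which the library only attaches to the alias R[i]^o. *)
HB.instance Definition _ (R : rcfType) := NormedModule.copy R[i] R[i]^o.

Record dynamical_system := DynamicalSystem {
  ds_space :> topologicalType;
  ds_nonempty : [set: ds_space] !=set0;
  ds_compact : compact [set: ds_space];
  ds_hausdorff : hausdorff_space ds_space;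
  ds_homeo : ds_space -> ds_space;
  ds_homeo_inv : ds_space -> ds_space;
  ds_homeoK : cancel ds_homeo ds_homeo_inv;
  ds_homeo_invK : cancel ds_homeo_inv ds_homeo;
  ds_homeo_continuous : continuous ds_homeo;
  ds_homeo_inv_continuous : continuous ds_homeo_inv
}.

Section UniformSums.
Context (R : realType) (X : topologicalType).
Local Notation C := R[i].

(* Every f : X -> C has a supremum norm in the extended reals; it is finite
   for a continuous f on a compact X. *)
Definition supnorm (f : X -> C) : \bar R :=
  ereal_sup [set (normc (f x))%:E | x in [set: X]].

(* The sum of an unordered series of functions for the supremum norm, that is,
   the limit of its finite partial sums for uniform convergence on X.
   [unif_sumP] below gives its existence for dominated series, in particular
   for the series defining the product of two elements of [ell1]. *)
Definition unif_sum (I : choiceType) (f : I -> X -> C) : X -> C :=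
  xget (fun=> 0) [set g : X -> C |
    {uniform, (fun (A : {fset I}) (x : X) => \sum_(i <- A) f i x)
              @ @summability.totally I --> g}].

End UniformSums.

Section Ell1.
Context (R : realType) (S : dynamical_system).
Local Notation C := R[i].

Definition alpha (f : S -> C) : S -> C := f \o @ds_homeo_inv S.
Definition alpha_inv (f : S -> C) : S -> C := f \o @ds_homeo S.
Definition alphaz (k : int) (f : S -> C) : S -> C :=
  match k with
  | Posz n => iter n alpha f
  | Negz n => iter n.+1 alpha_inv f
  end.

Definition ell1_norm (a : int -> S -> C) : \bar R :=
  (\esum_(n in [set: int]) supnorm (a n))%E.

Record ell1 := Ell1 {
  ell1_fun :> int -> S -> C;
  ell1_continuous : forall n, continuous (ell1_fun n);
  ell1_summable : (ell1_norm ell1_fun < +oo)%E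
}.

Definition conv (a b : int -> S -> C) (n : int) : S -> C :=
  unif_sum (fun k x => a k x * alphaz k (b (n - k)) x).

Definition star (a : int -> S -> C) (n : int) : S -> C :=
  fun x => (alphaz n (a (- n)) x)^*.

End Ell1.

Section BoundedSums.
Context (R : realType).
Local Notation C := R[i].

Definition sums_le (I : choiceType) (M : I -> R) (T : R) :=
  forall A : {fset I}, \sum_(i <- A) M i <= T.

Lemma sums_le_ge0 (I : choiceType) (M : I -> R) T : sums_le M T -> 0 <= T.
Proof. by move=> /(_ fset0); rewrite big_seq_fset0. Qed.

Lemma sums_le_sub (I : choiceType) (M N : I -> R) T :
  (forall i, M i <= N i) -> sums_le N T -> sums_le M T.
Proof. by move=> MN + A => /(_ A); apply: le_trans; exact: ler_sum. Qed.

Lemma esum_sums_le (I : choiceType) (M : I -> R) T : sums_le M T ->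
  (\esum_(i in setT) (M i)%:E <= T%:E)%E.
Proof.
move=> MT; apply: ge_ereal_sup => _ [A [finA _] <-].
by rewrite fsbig_finite//= sumEFin lee_fin; exact: MT.
Qed.

Lemma sums_le_esum (I : choiceType) (M : I -> R) :
  (forall i, 0 <= M i) -> (\esum_(i in setT) (M i)%:E < +oo)%E ->
  sums_le M (fine (\esum_(i in setT) (M i)%:E)).
Proof.
move=> M0 Moo A; rewrite -lee_fin fineK; last first.
  by rewrite ge0_fin_numE//; apply: esum_ge0 => i _; rewrite lee_fin.
apply: ereal_sup_ubound; exists [set` A]; first by split.
by rewrite -fsbig_seq// sumEFin.
Qed.

Lemma ler_sum_fset (I : choiceType) (M : I -> R) (A B : {fset I}) :
  (forall i, 0 <= M i) -> (A `<=` B)%fset ->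
  \sum_(i <- A) M i <= \sum_(i <- B) M i.
Proof.
move=> M0 AB; rewrite (big_fsetID _ (fun i => i \in A) B)/=.
rewrite (_ : [fset x in B | x \in A]%fset = A) ?lerDl ?sumr_ge0//.
by apply/fsetP => i; rewrite !inE/= andb_idl// => /(fsubsetP AB).
Qed.

Lemma sums_le_sup (I : choiceType) (M : I -> R) T : (forall i, 0 <= M i) ->
  sums_le M T ->
  exists2 S, sums_le M S & forall e, 0 < e -> exists A : {fset I},
    forall B : {fset I}, (A `<=` B)%fset -> S - e < \sum_(i <- B) M i.
Proof.
move=> M0 MT; pose E := [set x | exists A : {fset I}, x = \sum_(i <- A) M i].
have supE : has_sup E.
  split; first by exists (\sum_(i <- fset0) M i); exists fset0.
  by exists T => _ [A ->]; exact: MT.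
exists (sup E).
  by move=> A; apply: sup_upper_bound => //; exists A.
move=> e e0; have [_ [A ->] SA] := sup_adherent e0 supE.
by exists A => B AB; apply: (lt_le_trans SA); exact: ler_sum_fset.
Qed.

Lemma normc_sum (I : Type) (s : seq I) (f : I -> C) :
  normc (\sum_(i <- s) f i) <= \sum_(i <- s) normc (f i).
Proof.
elim: s => [|i s IH]; first by rewrite !big_nil normc0.
by rewrite !big_cons; apply: (le_trans (le_normcD _ _)); rewrite lerD2l.
Qed.

Lemma normcB (x y : C) : normc (x - y) = normc (y - x).
Proof. by rewrite -normcN opprB. Qed.

Lemma normc_ge0 (x : C) : 0 <= normc x.
Proof. by case: x => a b; exact: sqrtr_ge0. Qed.

Lemma normc_real (x : R) : normc x%:C = `|x|.
Proof. by rewrite /= expr0n/= addr0 sqrtr_sqr. Qed.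

Lemma normc_distD (x y z : C) : normc (x - z) <= normc (x - y) + normc (y - z).
Proof. by rewrite -(subrKA y x); exact: le_normcD. Qed.

Lemma normc_small0 (x : C) : (forall e, 0 < e -> normc x <= e) -> x = 0.
Proof.
move=> xe; apply: eq0_normc; apply/eqP; rewrite eq_le normc_ge0 andbT.
by apply/ler_addgt0Pr => e /xe; rewrite add0r.
Qed.

Definition has_sum (I : choiceType) (f : I -> C) (s : C) :=
  forall e : R, 0 < e -> exists A : {fset I}, forall B : {fset I},
    (A `<=` B)%fset -> normc (\sum_(i <- B) f i - s) < e.

Lemma has_sum_unique (I : choiceType) (f : I -> C) s t :
  has_sum f s -> has_sum f t -> s = t.
Proof.
move=> fs ft; apply/subr0_eq/normc_small0 => e e0.
have e20 : 0 < e / 2 by rewrite divr_gt0.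
have [A sA] := fs _ e20; have [B tB] := ft _ e20.
apply: (le_trans (normc_distD _ (\sum_(i <- (A `|` B)%fset) f i) _)).
rewrite (splitr e) lerD//.
  by rewrite normcB; apply/ltW/sA; exact: fsubsetUl.
by apply/ltW/tB; exact: fsubsetUr.
Qed.

Lemma has_sum_lin (I : choiceType) (f g : I -> C) (c s t : C) :
  has_sum f s -> has_sum g t -> has_sum (fun i => c * f i + g i) (c * s + t).
Proof.
move=> fs gt e e0; pose d := e / 2 / (normc c + 1).
have c0 : 0 < normc c + 1 by rewrite ltr_wpDl ?normc_ge0.
have e20 : 0 < e / 2 by rewrite divr_gt0.
have [A sA] := fs d (divr_gt0 e20 c0); have [B tB] := gt _ e20.
exists (A `|` B)%fset => D; rewrite fsubUset => /andP[AD BD].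
rewrite big_split/= -mulr_sumr opprD addrACA -mulrBr.
apply: (le_lt_trans (le_normcD _ _)); rewrite (splitr e) ler_ltD ?tB// normcM.
have -> : e / 2 = (normc c + 1) * d by rewrite /d [RHS]mulrC divfK ?gt_eqF.
apply: ler_pM; rewrite ?normc_ge0 ?lerDl//.
exact/ltW/sA.
Qed.

Lemma has_sum0 (I : choiceType) : has_sum (fun=> 0 : C) (0 : C) (I := I).
Proof. by move=> e e0; exists fset0 => B _; rewrite big1// subrr normc0. Qed.

Lemma has_sumZ (I : choiceType) (f : I -> C) (c s : C) :
  has_sum f s -> has_sum (fun i => c * f i) (c * s).
Proof.
move=> /(has_sum_lin c)/(_ (@has_sum0 I)); rewrite addr0.
by under eq_fun do rewrite addr0.
Qed.

Lemma has_sum1 (I : choiceType) (j : I) (c : C) :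
  has_sum (fun i => if i == j then c else 0) c.
Proof.
move=> e e0; exists [fset j]%fset => B; rewrite fsub1set => jB.
rewrite (big_fsetD1 j)//= eqxx big1_fset ?addr0 ?subrr ?normc0// => i.
by rewrite !inE => /andP[/negPf ->].
Qed.

Lemma has_sum_conj (I : choiceType) (f : I -> C) s :
  has_sum f s -> has_sum (fun i => (f i)^*) s^*.
Proof.
move=> fs e /fs[A sA]; exists A => B /sA; rewrite -rmorph_sum -rmorphB.
by case: (_ - _) => u v /=; rewrite sqrrN.
Qed.

Lemma has_sum_bij (I J : choiceType) (h : J -> I) (k : I -> J) (f : I -> C) s :
  cancel h k -> cancel k h -> has_sum f s -> has_sum (f \o h) s.
Proof.
move=> hk kh fs e /fs[A sA]; exists [fset k i | i in A]%fset => B AB.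
have := sA [fset h j | j in B]%fset; rewrite big_imfset/=; last first.
  by move=> i j _ _; exact: (can_inj hk).
apply; apply/fsubsetP => i iA; apply/imfsetP; exists (k i) => //=.
by apply: (fsubsetP AB); rewrite in_imfset.
Qed.

Lemma sums_le_bij (I J : choiceType) (h : J -> I) (k : I -> J) (M : I -> R) T :
  cancel h k -> sums_le M T -> sums_le (M \o h) T.
Proof.
move=> hk MT A; have := MT [fset h j | j in A]%fset.
by rewrite big_imfset//= => i j _ _; exact: (can_inj hk).
Qed.

Lemma has_sum_nneg (I : choiceType) (M : I -> R) T : (forall i, 0 <= M i) ->
  sums_le M T -> exists s, has_sum (fun i => (M i)%:C) s.
Proof.
move=> M0 MT; have [S MS SM] := sums_le_sup M0 MT.
exists S%:C => e /SM[A SA]; exists A => B /SA SB.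
rewrite -rmorph_sum -rmorphB normc_real distrC ger0_norm ?subr_ge0 ?MS//.
by rewrite ltrBlDr addrC -ltrBlDr.
Qed.

Lemma has_sum_real (I : choiceType) (f M : I -> R) T :
  (forall i, `|f i| <= M i) ->
  sums_le M T -> exists s, has_sum (fun i => (f i)%:C) s.
Proof.
move=> fM MT.
have M0 i : 0 <= M i by rewrite (le_trans _ (fM i)).
have [s sM] := has_sum_nneg M0 MT.
have [||t tM] := @has_sum_nneg _ (fun i => f i + M i) (T + T).
- by move=> i; have := fM i; rewrite ler_norml => /andP[+ _]; rewrite -subr_ge0 opprK.
- move=> A; rewrite big_split lerD// ?MT//.
  by apply: le_trans (MT A); apply: ler_sum => i _; exact: le_trans (ler_norm _) (fM i).
exists (-1 * s + t); move: (has_sum_lin (-1) sM tM).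
by under eq_fun do rewrite mulN1r rmorphD/= addrC addrK.
Qed.

Lemma normc_ge_ReIm (z : C) : `|complex.Re z| <= normc z /\ `|complex.Im z| <= normc z.
Proof.
by case: z => a b /=; rewrite -!sqrtr_sqr; split; apply: ler_wsqrtr;
  rewrite ?lerDl ?lerDr sqr_ge0.
Qed.

Lemma has_sum_abs (I : choiceType) (f : I -> C) (M : I -> R) T :
  (forall i, normc (f i) <= M i) -> sums_le M T -> exists s, has_sum f s.
Proof.
move=> fM MT.
have [|s sf] := @has_sum_real _ (@complex.Re R \o f) M T _ MT.
  by move=> i; have [+ _] := normc_ge_ReIm (f i) => /le_trans; apply.
have [|t tf] := @has_sum_real _ (@complex.Im R \o f) M T _ MT.
  by move=> i; have [_ +] := normc_ge_ReIm (f i) => /le_trans; apply.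
exists ('i * t + s); have := has_sum_lin 'i tf sf.
by congr has_sum; apply/funext => i /=; rewrite addrC -complexE.
Qed.

Lemma has_sum_le (I : choiceType) (f : I -> C) (M : I -> R) T s :
  (forall i, normc (f i) <= M i) -> sums_le M T -> has_sum f s -> normc s <= T.
Proof.
move=> fM MT fs; apply/ler_addgt0Pr => e /fs[A /(_ A (fsubset_refl _)) sA].
rewrite -[s](subrK (\sum_(i <- A) f i)); apply: (le_trans (le_normcD _ _)).
rewrite [leRHS]addrC; apply: lerD; first by rewrite normcB; exact: ltW.
apply: le_trans (MT A).
by apply: (le_trans (normc_sum _ _)); exact: ler_sum.
Qed.

Lemma has_sum_tail (I : choiceType) (M : I -> R) T :
  (forall i, 0 <= M i) -> sums_le M T ->
  forall e, 0 < e -> exists A : {fset I}, forall B : {fset I}, (A `<=` B)%fset ->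
  forall (f : I -> C) s, (forall i, normc (f i) <= M i) -> has_sum f s ->
    normc (\sum_(i <- B) f i - s) < e.
Proof.
move=> M0 MT e e0; have [S MS SM] := sums_le_sup M0 MT.
have e20 : 0 < e / 2 by rewrite divr_gt0.
have [A SA] := SM _ e20; exists A => B AB f s fM fs.
have [D sD] := fs _ e20.
apply: (le_lt_trans (normc_distD _ (\sum_(i <- (B `|` D)%fset) f i) _)).
rewrite (splitr e) ler_ltD//; last by apply: sD; exact: fsubsetUr.
rewrite normcB (big_fsetID _ (fun i => i \in B) (B `|` D)%fset)/=.
rewrite (_ : [fset x in B `|` D | x \in B]%fset = B); last first.
  by apply/fsetP => i; rewrite !inE/= andb_idl// => ->.
rewrite addrC addrK; apply: (le_trans (normc_sum _ _)).
apply: (@le_trans _ _ (\sum_(i <- (B `|` D)%fset) M i - \sum_(i <- B) M i)).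
  rewrite (big_fsetID _ (fun i => i \in B) (B `|` D)%fset)/=.
  rewrite (_ : [fset x in B `|` D | x \in B]%fset = B); last first.
    by apply/fsetP => i; rewrite !inE/= andb_idl// => ->.
  by rewrite addrC addrK; exact: ler_sum.
rewrite lerBlDr (le_trans (MS _))// -lerBlDl.
exact/ltW/SA.
Qed.

Lemma has_sum_pair (I J : choiceType) (f : I * J -> C) (g : I -> C) s :
  has_sum f s -> (forall i, has_sum (fun j => f (i, j)) (g i)) -> has_sum g s.
Proof.
move=> fs fg e e0; have e20 : 0 < e / 2 by rewrite divr_gt0.
have [A sA] := fs _ e20.
exists [fset p.1 | p in A]%fset => B AB.
pose d := e / 2 / (#|` B|%:R + 1).
have d0 : 0 < d by rewrite divr_gt0// ltr_wpDl.
have /choice[D gD] i := fg i _ d0.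
pose E := (\bigcup_(i <- B) D i `|` [fset p.2 | p in A])%fset.
have gE i : i \in B -> normc (\sum_(j <- E) f (i, j) - g i) < d.
  move=> iB; apply: gD; rewrite /E; apply/fsubsetU/orP; left.
  exact: bigfcup_sup.
have AE : (A `<=` B `*` E)%fset.
  apply/fsubsetP => p pA; rewrite inE; apply/andP; split.
    by apply: (fsubsetP AB); rewrite in_imfset.
  by rewrite /E inE; apply/orP; right; rewrite in_imfset.
have BE : \sum_(p <- (B `*` E)%fset) f p = \sum_(i <- B) \sum_(j <- E) f (i, j).
  rewrite (perm_big _ (enum_imfset2 _ _))/=; last first.
    by move=> [? ?] [? ?] _ _ /= [-> ->].
  by rewrite big_allpairs_dep/=.
apply: (le_lt_trans (normc_distD _ (\sum_(p <- (B `*` E)%fset) f p) _)).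
rewrite (splitr e) ler_ltD//; last exact: sA.
rewrite BE -sumrB; apply: (le_trans (normc_sum _ _)).
apply: (@le_trans _ _ (\sum_(i <- B) d)).
  rewrite big_seq [leRHS]big_seq.
  by apply: ler_sum => i iB; rewrite normcB; exact/ltW/gE.
rewrite big_const_seq count_predT iter_addr_0 -[d *+ _]mulr_natl.
rewrite /d mulrCA ler_piMr ?(ltW e20)//.
by rewrite ler_pdivrMr ?ltr_wpDl// mul1r lerDl.
Qed.

Lemma sums_le_pair (I J : choiceType) (M : I -> R) (N : I -> J -> R) S T :
  (forall i, 0 <= M i) -> (forall i j, 0 <= N i j) ->
  0 <= T -> sums_le M S -> (forall i, sums_le (N i) T) ->
  sums_le (fun p : I * J => M p.1 * N p.1 p.2) (S * T).
Proof.
move=> M0 N0 T0 MS NT A; pose A1 := [fset p.1 | p in A]%fset.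
pose A2 := [fset p.2 | p in A]%fset.
apply: (@le_trans _ _ (\sum_(p <- (A1 `*` A2)%fset) M p.1 * N p.1 p.2)).
  apply: ler_sum_fset => [p|]; first exact: mulr_ge0.
  by apply/fsubsetP => p pA; rewrite inE !in_imfset.
rewrite (perm_big _ (enum_imfset2 _ _))/=; last first.
  by move=> [? ?] [? ?] _ _ /= [-> ->].
rewrite big_allpairs_dep/=.
apply: (@le_trans _ _ (\sum_(i <- A1) M i * T)).
  by apply: ler_sum => i _; rewrite -mulr_sumr ler_wpM2l// NT.
by rewrite -mulr_suml ler_wpM2r.
Qed.

End BoundedSums.

Section UniformSumsTheory.
Context (R : realType) (X : topologicalType).
Local Notation C := R[i].

Lemma normc_norm (z : C) : `|z| = (normc z)%:C.
Proof. by case: z => a b; rewrite normc_def. Qed.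

Lemma ball_normc (z w : C) (e : R) : ball z e%:C w <-> normc (z - w) < e.
Proof. by rewrite -ball_normE/= normc_norm ltcR. Qed.

Lemma real_eps (e : C) : 0 < e -> exists2 r : R, 0 < r & e = r%:C.
Proof.
case: e => a b; rewrite ltcE/= => /andP[/eqP -> a0].
by exists a.
Qed.

Lemma unif_cvgP (I : choiceType) (F : {fset I} -> X -> C) (g : X -> C) :
  {uniform, F @ @summability.totally I --> g} <->
  forall e : R, 0 < e -> exists A : {fset I}, forall B, (A `<=` B)%fset ->
    forall x, normc (F B x - g x) < e.
Proof.
split=> [Fg e e0|Fg P /uniform_nbhs[E [+ EP]]].
  have /Fg[/= A _ AE] : nbhs (g : {uniform X -> C})
      [set h | forall x, normc (h x - g x) < e].
    apply/uniform_nbhs; exists [set xy | ball xy.1 e%:C xy.2]; split.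
      rewrite -entourage_from_ballE; exists e%:C => //=.
      by rewrite ltcR.
    by move=> h /= gh x; have /ball_normc := gh x Logic.I; rewrite normcB.
  by exists A => B /AE.
rewrite -entourage_from_ballE => -[_ /real_eps[e e0 ->] eE].
have [A AF] := Fg _ e0; exists A => // B AB; apply: EP => x _; apply: eE => /=.
by apply/ball_normc; rewrite normcB; exact: AF.
Qed.

Lemma unif_sumP (I : choiceType) (f : I -> X -> C) (M : I -> R) T :
  (forall i x, normc (f i x) <= M i) -> sums_le M T ->
  {uniform, (fun (A : {fset I}) (x : X) => \sum_(i <- A) f i x)
            @ @summability.totally I --> unif_sum f} /\
  (forall x, has_sum (f^~ x) (unif_sum f x)).
Proof.
move=> fM MT.
have /choice[g fg] x : exists s, has_sum (f^~ x) s.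
  by apply: has_sum_abs MT => i; exact: fM.
suff fu : {uniform, (fun (A : {fset I}) (x : X) => \sum_(i <- A) f i x)
            @ @summability.totally I --> unif_sum f}.
  by split=> // x e e0; have [A fA] := (unif_cvgP _ _).1 fu e e0;
     exists A => B /fA.
pose P := [set h : X -> C |
  {uniform, (fun (A : {fset I}) (x : X) => \sum_(i <- A) f i x)
            @ @summability.totally I --> h}].
suff Pg : P g by have := @xgetPex _ (fun=> 0) P (ex_intro _ g Pg).
apply/unif_cvgP => e e0.
have [x0|X0] := pselect (exists x : X, True); last first.
  by exists fset0 => B _ x; exfalso; apply: X0; exists x.
have M0 i : 0 <= M i.
  by have [x _] := x0; apply: le_trans (fM i x); exact: normc_ge0.
have [A AM] := has_sum_tail M0 MT e0.
by exists A => B AB x; apply: AM => // i.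
Qed.

Lemma continuousPc (f : X -> C) :
  continuous f <-> forall x (e : R), 0 < e -> \forall y \near x, normc (f x - f y) < e.
Proof.
split=> fc x.
  move=> e e0; have /cvgrPdist_lt/(_ e%:C) := fc x.
  rewrite ltcR => /(_ e0); apply: filterS => y.
  by rewrite normc_norm ltcR.
apply/cvgrPdist_lt => _ /real_eps[e e0 ->]; have := fc x e e0.
by apply: filterS => y; rewrite normc_norm ltcR.
Qed.

Lemma continuous_sumc (I : Type) (s : seq I) (f : I -> X -> C) :
  (forall i, continuous (f i)) -> continuous (fun x => \sum_(i <- s) f i x).
Proof.
move=> fc; elim: s => [|i s IH].
  by under eq_fun do rewrite big_nil; move=> x; exact: cvg_cst.
under eq_fun do rewrite big_cons.
by move=> x; apply: cvgD; [exact: fc|exact: IH].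
Qed.

Lemma continuous_unif_sum (I : choiceType) (f : I -> X -> C) (M : I -> R) T :
  (forall i x, normc (f i x) <= M i) -> sums_le M T ->
  (forall i, continuous (f i)) -> continuous (unif_sum f).
Proof.
move=> fM MT fc; have [fu _] := unif_sumP fM MT.
refine (@uniform_limit_continuous _ _ _ _ (fmap_proper_filter _ _) _ fu).
  exact: summability.totally_filter.
by exists fset0 => // B _ /=; exact: continuous_sumc.
Qed.

Lemma supnorm_ge (f : X -> C) x : ((normc (f x))%:E <= supnorm f)%E.
Proof. by apply: ereal_sup_ubound; exists x. Qed.

Lemma supnorm_le (f : X -> C) (M : \bar R) :
  (forall x, (normc (f x))%:E <= M)%E -> (supnorm f <= M)%E.
Proof. by move=> fM; apply: ge_ereal_sup => _ [x _ <-]. Qed.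

Lemma supnorm_ge0 (f : X -> C) : [set: X] !=set0 -> (0 <= supnorm f)%E.
Proof.
by move=> [x _]; apply: le_trans (supnorm_ge f x); rewrite lee_fin normc_ge0.
Qed.

End UniformSumsTheory.

Section Ell1Theory.
Context (R : realType) (S : dynamical_system).
Local Notation C := R[i].
Local Notation ell1 := (ell1 R S).
Implicit Types (a b c : ell1) (x : S) (k m n : int).

(* [sigz k] is the (- k)-th power of the homeomorphism, so that
   [alphaz k f = f \o sigz k]. *)
Definition sigz k : S -> S :=
  match k with
  | Posz n => iter n (@ds_homeo_inv S)
  | Negz n => iter n.+1 (@ds_homeo S)
  end.

Lemma alphazE k (f : S -> C) x : alphaz k f x = f (sigz k x).
Proof.
have iterE (g : S -> S) (n : nat) : iter n (fun f : S -> C => f \o g) f x = f (iter n g x).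
  by elim: n x => //= n IH x; rewrite IH -iterSr.
by case: k => n; exact: iterE.
Qed.

Lemma sigz0 x : sigz 0 x = x. Proof. by []. Qed.

Lemma sigzS k x : sigz (k + 1) x = ds_homeo_inv (sigz k x).
Proof.
case: k => n; first by rewrite -PoszD addn1.
case: n => [|n]; first by rewrite /= ds_homeoK.
rewrite (_ : Negz n.+1 + 1 = Negz n); last by rewrite !NegzE -addn1 PoszD; ring.
by rewrite [in RHS]/sigz iterS ds_homeoK.
Qed.

Lemma sigzP k x : sigz (k - 1) x = ds_homeo (sigz k x).
Proof. by rewrite -{2}(subrK 1 k) sigzS ds_homeo_invK. Qed.

Lemma sigzD j k x : sigz (j + k) x = sigz j (sigz k x).
Proof.
elim/int_ind: j => [|n IH|n IH]; first by rewrite add0r.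
  by rewrite -addn1 PoszD addrAC !sigzS IH.
rewrite -addn1 PoszD opprD addrAC !sigzP IH//.
Qed.

Lemma sigzNK k x : sigz (- k) (sigz k x) = x.
Proof. by rewrite -sigzD addNr. Qed.

Lemma sigz_continuous k : continuous (sigz k).
Proof.
have iterc (g : S -> S) (n : nat) : continuous g -> continuous (iter n g).
  move=> gc; elim: n => [|n IH] x /=; first exact: cvg_id.
  by apply: continuous_comp; [exact: IH|exact: gc].
case: k => n; apply: iterc.
  exact: ds_homeo_inv_continuous.
exact: ds_homeo_continuous.
Qed.

Lemma continuous_alphaz k (f : S -> C) : continuous f -> continuous (alphaz k f).
Proof.
move=> fc; rewrite (_ : alphaz k f = f \o sigz k); last first.
  by apply/funext => x; exact: alphazE.
by move=> x; apply: continuous_comp; [exact: sigz_continuous|exact: fc].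
Qed.

Lemma supnorm_ell1_ge0 (f : S -> C) : (0 <= supnorm f)%E.
Proof. exact/supnorm_ge0/ds_nonempty. Qed.

Definition nrm a n : R := fine (supnorm (a n)).

Lemma supnorm_fin a n : supnorm (a n) = (nrm a n)%:E.
Proof.
rewrite fineK// ge0_fin_numE ?supnorm_ell1_ge0//.
apply: le_lt_trans (ell1_summable a); apply: esum_ge.
by exists [set n]; [split; [exact: finite_set1|] | rewrite fsbig_set1].
Qed.

Lemma nrm_ge0 a n : 0 <= nrm a n.
Proof. by rewrite -lee_fin -supnorm_fin supnorm_ell1_ge0. Qed.

Lemma nrm_ge a n x : normc (a n x) <= nrm a n.
Proof. by rewrite -lee_fin -supnorm_fin supnorm_ge. Qed.

Definition nrm1 a : R := fine (ell1_norm a).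

Lemma nrm_sums a : sums_le (nrm a) (nrm1 a).
Proof.
have E : ell1_norm a = \esum_(n in [set: int]) (nrm a n)%:E.
  by apply: eq_esum => n _; exact: supnorm_fin.
rewrite /nrm1 E; apply: sums_le_esum; first exact: nrm_ge0.
by rewrite -E; exact: ell1_summable.
Qed.

Lemma nrm1_ge0 a : 0 <= nrm1 a.
Proof. exact: sums_le_ge0 (nrm_sums a). Qed.

Lemma nrm_le a n : nrm a n <= nrm1 a.
Proof. by have := nrm_sums a [fset n]%fset; rewrite big_seq_fset1. Qed.

Lemma ell1_summable_intro (f : int -> S -> C) (M : int -> R) T :
  (forall n x, normc (f n x) <= M n) -> sums_le M T ->
  (\esum_(n in [set: int]) supnorm (f n) < +oo)%E.
Proof.
move=> fM MT; apply: (@le_lt_trans _ _ T%:E); last exact: ltry.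
apply: le_trans (esum_sums_le MT); apply: le_esum => n _.
by apply: supnorm_le => x; rewrite lee_fin.
Qed.

Lemma ell1P a b : (forall n x, a n x = b n x) -> a = b.
Proof.
case: a b => [f fc fs] [g gc gs] /= fg.
have E : f = g by apply/funext => n; apply/funext => x; exact: fg.
by case: _ / E in gc gs *; congr Ell1; exact: Prop_irrelevance.
Qed.

Definition zero_fun n : S -> C := fun=> 0.

Lemma zero_continuous n : continuous (zero_fun n).
Proof. by move=> x; exact: cvg_cst. Qed.

Lemma zero_summable :
  (\esum_(n in [set: int]) supnorm (zero_fun n) < +oo)%E.
Proof.
apply: (@ell1_summable_intro _ (fun=> 0) 0) => [n x|A]; first by rewrite normc0.
by rewrite big1.
Qed.

Definition ell1_zero : ell1 := Ell1 zero_continuous zero_summable.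

Lemma opp_continuous a n : continuous (fun x => - a n x).
Proof. by move=> x; apply: cvgN; exact: ell1_continuous. Qed.

Lemma opp_summable a : (\esum_(n in [set: int]) supnorm (fun x => (- a n x)%R) < +oo)%E.
Proof.
by apply: ell1_summable_intro (nrm_sums a) => n x; rewrite normcN nrm_ge.
Qed.

Definition ell1_opp a : ell1 := Ell1 (@opp_continuous a) (opp_summable a).

Lemma add_continuous a b n : continuous (fun x => a n x + b n x).
Proof. by move=> x; apply: cvgD; exact: ell1_continuous. Qed.

Lemma add_summable a b :
  (\esum_(n in [set: int]) supnorm (fun x => (a n x + b n x)%R) < +oo)%E.
Proof.
apply: (@ell1_summable_intro _ (fun n => nrm a n + nrm b n) (nrm1 a + nrm1 b)).
  by move=> n x; apply: (le_trans (le_normcD _ _)); rewrite lerD// nrm_ge.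
by move=> A; rewrite big_split lerD// nrm_sums.
Qed.

Definition ell1_add a b : ell1 := Ell1 (@add_continuous a b) (add_summable a b).

Lemma scale_continuous (z : C) a n : continuous (fun x => z * a n x).
Proof.
move=> x.
apply: (@cvgM R[i] _ _ _ (cst z) (a n) z (a n x)); first exact: cvg_cst.
exact: ell1_continuous.
Qed.

Lemma scale_summable (z : C) a :
  (\esum_(n in [set: int]) supnorm (fun x => (z * a n x)%R) < +oo)%E.
Proof.
apply: (@ell1_summable_intro _ (fun n => normc z * nrm a n) (normc z * nrm1 a)).
  by move=> n x; rewrite normcM ler_wpM2l ?normc_ge0 ?nrm_ge.
by move=> A; rewrite -mulr_sumr ler_wpM2l ?normc_ge0 ?nrm_sums.
Qed.

Definition ell1_scale (z : C) a : ell1 :=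
  Ell1 (@scale_continuous z a) (scale_summable z a).

Definition one_fun n : S -> C := fun=> if n == 0 then 1 else 0.

Lemma one_continuous n : continuous (one_fun n).
Proof. by move=> x; exact: cvg_cst. Qed.

Lemma one_summable : (\esum_(n in [set: int]) supnorm (one_fun n) < +oo)%E.
Proof.
apply: (@ell1_summable_intro _ (fun n => if n == 0 then 1 else 0) 1).
  by move=> n x; rewrite /one_fun; case: eqP; rewrite ?normc0// normc1.
move=> A; rewrite -big_mkcond/= big_fset_condE.
apply: (@le_trans _ _ (\sum_(i <- [fset (0:int)]%fset) 1)).
  apply: ler_sum_fset => //; apply/fsubsetP => i.
  by rewrite !inE/= => /andP[_].
by rewrite big_seq_fset1.
Qed.

Definition ell1_one : ell1 := Ell1 one_continuous one_summable.

Lemma conv_term_le a b n k x :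
  normc (a k x * alphaz k (b (n - k)) x) <= nrm a k * nrm b (n - k).
Proof.
by rewrite normcM alphazE ler_pM ?normc_ge0 ?nrm_ge.
Qed.

Lemma nrm_shift_sums b n : sums_le (fun k => nrm b (k - n)) (nrm1 b).
Proof.
by apply: (@sums_le_bij _ _ _ (fun k => k - n) (fun k => k + n) (nrm b) _ _
  (nrm_sums b)) => k; rewrite subrK.
Qed.

Lemma nrm_refl_sums b n : sums_le (fun k => nrm b (n - k)) (nrm1 b).
Proof.
by apply: (@sums_le_bij _ _ _ (fun k => n - k) (fun k => n - k) (nrm b) _ _
  (nrm_sums b)) => k; rewrite subKr.
Qed.

Lemma conv_sums a b n :
  sums_le (fun k => nrm a k * nrm b (n - k)) (nrm1 a * nrm1 b).
Proof.
apply: (@sums_le_sub _ _ _ (fun k => nrm a k * nrm1 b)) => [k|A].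
  by rewrite ler_wpM2l ?nrm_ge0 ?nrm_le.
by rewrite -mulr_suml ler_wpM2r ?nrm1_ge0 ?nrm_sums.
Qed.

Lemma conv_has_sum a b n x :
  has_sum (fun k => a k x * b (n - k) (sigz k x)) (conv a b n x).
Proof.
have [_ /(_ x)] := unif_sumP (conv_term_le a b n) (conv_sums a b n).
by congr has_sum; apply/funext => k; rewrite alphazE.
Qed.

Lemma conv_continuous a b n : continuous (conv a b n).
Proof.
apply: continuous_unif_sum (conv_term_le a b n) (conv_sums a b n) _ => k x.
apply: (@cvgM R[i] _ _ _ (a k) (alphaz k (b (n - k)))).
  exact: ell1_continuous.
by apply: continuous_alphaz; exact: ell1_continuous.
Qed.

Lemma conv_pair_sums a b :
  sums_le (fun p : int * int => nrm a p.2 * nrm b (p.1 - p.2)) (nrm1 a * nrm1 b).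
Proof.
have := @sums_le_pair R int int (nrm a) (fun k n => nrm b (n - k)) _ _
  (nrm_ge0 a) (fun k n => nrm_ge0 b (n - k)) (nrm1_ge0 b) (nrm_sums a)
  (nrm_shift_sums b).
by move=> /(@sums_le_bij _ _ _ (fun p : int * int => (p.2, p.1))
  (fun p => (p.2, p.1)) _ _ _); apply; case.
Qed.

Lemma conv_summable a b : (\esum_(n in [set: int]) supnorm (conv a b n) < +oo)%E.
Proof.
pose N n := (\esum_(k in [set: int]) (nrm a k * nrm b (n - k))%:E)%E.
apply: (@le_lt_trans _ _ (\esum_(n in [set: int]) N n)%E).
  apply: le_esum => n _.
  have N0 : (0 <= N n)%E.
    by apply: esum_ge0 => k _; rewrite lee_fin mulr_ge0 ?nrm_ge0.
  have Nfin : N n \is a fin_num.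
    rewrite ge0_fin_numE//.
    by apply: le_lt_trans (esum_sums_le (conv_sums a b n)) _; exact: ltry.
  apply: supnorm_le => x; rewrite -(fineK Nfin) lee_fin.
  apply: has_sum_le (conv_has_sum a b n x).
    by move=> k; rewrite -alphazE; exact: conv_term_le.
  apply: sums_le_esum; last by rewrite -ge0_fin_numE.
  by move=> k; rewrite mulr_ge0 ?nrm_ge0.
rewrite esum_esum; last by move=> n k _ _; rewrite lee_fin mulr_ge0 ?nrm_ge0.
rewrite (_ : [set: int] `*`` _ = setT); last by apply/seteqP; split=> -[].
exact: le_lt_trans (esum_sums_le (conv_pair_sums a b)) (ltry _).
Qed.

Definition ell1_mul a b : ell1 := Ell1 (@conv_continuous a b) (@conv_summable a b).

Lemma star_continuous a n : continuous (star a n).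
Proof.
apply/continuousPc => x e e0.
have /continuousPc/(_ x e e0) :=
  @continuous_alphaz n _ (@ell1_continuous _ _ a (- n)).
apply: filterS => y; rewrite /star -rmorphB.
by case: (_ - _) => u v /=; rewrite sqrrN.
Qed.

Lemma star_summable a : (\esum_(n in [set: int]) supnorm (star a n) < +oo)%E.
Proof.
apply: (@ell1_summable_intro _ (fun n => nrm a (- n)) (nrm1 a)).
  move=> n x; rewrite /star alphazE; apply: le_trans (nrm_ge a _ (sigz n x)).
  by case: (a _ _) => u v /=; rewrite sqrrN.
by apply: (@sums_le_bij _ _ _ (fun k => - k) (fun k => - k) (nrm a) _ _
  (nrm_sums a)) => k; rewrite opprK.
Qed.

Definition ell1_star a : ell1 := Ell1 (@star_continuous a) (star_summable a).

HB.instance Definition _ := gen_eqMixin ell1.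
HB.instance Definition _ := gen_choiceMixin ell1.

Lemma ell1_addA : associative ell1_add.
Proof. by move=> a b c; apply: ell1P => n x /=; rewrite addrA. Qed.
Lemma ell1_addC : commutative ell1_add.
Proof. by move=> a b; apply: ell1P => n x /=; rewrite addrC. Qed.
Lemma ell1_add0 : left_id ell1_zero ell1_add.
Proof. by move=> a; apply: ell1P => n x /=; rewrite add0r. Qed.
Lemma ell1_addN : left_inverse ell1_zero ell1_opp ell1_add.
Proof. by move=> a; apply: ell1P => n x /=; rewrite addNr. Qed.

HB.instance Definition _ :=
  GRing.isZmodule.Build ell1 ell1_addA ell1_addC ell1_add0 ell1_addN.

Lemma ell1_scaleA (z w : C) a : ell1_scale z (ell1_scale w a) = ell1_scale (z * w) a.
Proof. by apply: ell1P => n x /=; rewrite mulrA. Qed.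
Lemma ell1_scale1 : left_id 1 ell1_scale.
Proof. by move=> a; apply: ell1P => n x /=; rewrite mul1r. Qed.
Lemma ell1_scaleDr : right_distributive ell1_scale +%R.
Proof. by move=> z a b; apply: ell1P => n x /=; rewrite mulrDr. Qed.
Lemma ell1_scaleDl a : {morph ell1_scale^~ a : z w / z + w}.
Proof. by move=> z w; apply: ell1P => n x /=; rewrite mulrDl. Qed.

HB.instance Definition _ := GRing.Zmodule_isLmodule.Build C ell1
  ell1_scaleA ell1_scale1 ell1_scaleDr ell1_scaleDl.

Lemma ell1_mulA : associative ell1_mul.
Proof.
move=> a b c; apply: ell1P => n x.
pose F (p : int * int) :=
  a p.2 x * b (p.1 - p.2) (sigz p.2 x) * c (n - p.1) (sigz p.1 x).
have FM p : normc (F p) <= nrm a p.2 * nrm b (p.1 - p.2) * nrm1 c.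
  rewrite /F !normcM; apply: ler_pM; rewrite ?mulr_ge0 ?normc_ge0//.
    by apply: ler_pM; rewrite ?normc_ge0 ?nrm_ge.
  exact: le_trans (nrm_ge _ _ _) (nrm_le _ _).
have Fs : sums_le (fun p : int * int => nrm a p.2 * nrm b (p.1 - p.2) * nrm1 c)
    (nrm1 a * nrm1 b * nrm1 c).
  by move=> A; rewrite -mulr_suml ler_wpM2r ?nrm1_ge0 ?conv_pair_sums.
have [s sF] := has_sum_abs FM Fs.
transitivity s; last first.
  apply: (has_sum_unique _ (conv_has_sum (ell1_mul a b) c n x)).
  apply: has_sum_pair sF _ => m; rewrite /F/= mulrC.
  under eq_fun do rewrite mulrC.
  exact/has_sumZ/conv_has_sum.
apply: (has_sum_unique (conv_has_sum a (ell1_mul b c) n x)).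
pose h (p : int * int) := (p.2 + p.1, p.1).
have hF : has_sum (F \o h) s.
  apply: (@has_sum_bij _ _ _ h (fun p => (p.2, p.1 - p.2))) sF => -[u v] /=.
    by rewrite addrK.
  by rewrite /h/= subrK.
apply: has_sum_pair hF _ => k /=.
under eq_fun => j.
  rewrite /F/= addrK -mulrA sigzD.
  over.
apply: has_sumZ.
have := conv_has_sum b c (n - k) (sigz k x).
by congr has_sum; apply/funext => j; congr (_ * c _ _); ring.
Qed.

Lemma ell1_mul1l : left_id ell1_one ell1_mul.
Proof.
move=> a; apply: ell1P => n x.
apply: (has_sum_unique (conv_has_sum ell1_one a n x)).
have := has_sum1 (0 : int) (a n x); congr has_sum; apply/funext => k /=.
by rewrite /one_fun; case: eqP => [->|_]; rewrite ?mul0r// mul1r subr0.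
Qed.

Lemma ell1_mul1r : right_id ell1_one ell1_mul.
Proof.
move=> a; apply: ell1P => n x.
apply: (has_sum_unique (conv_has_sum a ell1_one n x)).
have := has_sum1 n (a n x); congr has_sum; apply/funext => k /=.
rewrite /one_fun subr_eq0 eq_sym; case: eqP => [->|_]; by rewrite ?mulr0// mulr1.
Qed.

Lemma ell1_mulDl : left_distributive ell1_mul +%R.
Proof.
move=> a b c; apply: ell1P => n x.
apply: (has_sum_unique (conv_has_sum (a + b) c n x)).
have := has_sum_lin 1 (conv_has_sum a c n x) (conv_has_sum b c n x).
rewrite mul1r; congr has_sum; apply/funext => k /=.
by rewrite mul1r mulrDl.
Qed.

Lemma ell1_mulDr : right_distributive ell1_mul +%R.
Proof.
move=> a b c; apply: ell1P => n x.
apply: (has_sum_unique (conv_has_sum a (b + c) n x)).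
have := has_sum_lin 1 (conv_has_sum a b n x) (conv_has_sum a c n x).
rewrite mul1r; congr has_sum; apply/funext => k /=.
by rewrite mul1r mulrDr.
Qed.

Lemma ell1_one_neq0 : ell1_one != 0.
Proof.
apply/eqP => /(congr1 (fun a : ell1 => a 0)) E.
have [x _] := ds_nonempty S; move: (congr1 (fun f => f x) E) => /= /eqP.
by rewrite /one_fun eqxx oner_eq0.
Qed.

HB.instance Definition _ := GRing.Zmodule_isNzRing.Build ell1
  ell1_mulA ell1_mul1l ell1_mul1r ell1_mulDl ell1_mulDr ell1_one_neq0.

Lemma ell1_scalerAl (z : C) a b : z *: (a * b) = (z *: a) * b.
Proof.
apply: ell1P => n x; apply: (@has_sum_unique _ _ _ _ _ _ (conv_has_sum (z *: a) b n x)).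
have := has_sumZ z (conv_has_sum a b n x); congr has_sum.
by apply/funext => k /=; rewrite mulrA.
Qed.

Lemma ell1_scalerAr (z : C) a b : z *: (a * b) = a * (z *: b).
Proof.
apply: ell1P => n x; apply: (@has_sum_unique _ _ _ _ _ _ (conv_has_sum a (z *: b) n x)).
have := has_sumZ z (conv_has_sum a b n x); congr has_sum.
by apply/funext => k /=; rewrite mulrCA.
Qed.

HB.instance Definition _ := GRing.Lmodule_isLalgebra.Build C ell1 ell1_scalerAl.
HB.instance Definition _ := GRing.Lalgebra_isAlgebra.Build C ell1 ell1_scalerAr.

Lemma ell1_starK : involutive ell1_star.
Proof.
move=> a; apply: ell1P => n x /=.
by rewrite /star !alphazE opprK sigzNK conjcK.
Qed.

Lemma ell1_star_mul a b : ell1_star (a * b) = ell1_star b * ell1_star a.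
Proof.
apply: ell1P => n x; rewrite /= /star alphazE.
have /has_sum_conj H := conv_has_sum a b (- n) (sigz n x).
apply: (has_sum_unique H).
have nK k : (n + k) - n = k by rewrite addrC addKr.
have Kn k : n + (k - n) = k by rewrite addrC subrK.
have := has_sum_bij nK Kn (conv_has_sum (ell1_star b) (ell1_star a) n x).
congr has_sum; apply/funext => k /=.
rewrite /star !alphazE -!sigzD rmorphM mulrC/=.
congr (_^* * _^*); first by congr (a _ (sigz _ x)); ring.
by congr (b _ (sigz _ x)); ring.
Qed.

End Ell1Theory.

Section Representations.
Context (K : fieldType) (A : algType K) (E : lmodType K).

Record representation := Representation {
  repr_op :> A -> {linear E -> E};
  repr_linear : forall v : E, linear (fun a => repr_op a v);
  repr_mul : forall (a b : A) (v : E), repr_op (a * b) v = repr_op a (repr_op b v)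
}.

Definition is_subspace (W : set E) :=
  W 0 /\ forall (z : K) (u v : E), W u -> W v -> W (z *: u + v).

Definition invariant_subspace (pi : representation) (W : set E) :=
  is_subspace W /\ forall (a : A) (v : E), W v -> W (pi a v).

Definition alg_irreducible (pi : representation) :=
  (exists (a : A) (v : E), pi a v != 0) /\
  forall W : set E, invariant_subspace pi W -> W = [set 0] \/ W = setT.

Definition repr_kernel (pi : representation) : set A :=
  [set a | forall v, pi a v = 0].

End Representations.

Definition primitive_ideal (K : fieldType) (A : algType K) (J : set A) :=
  exists (E : lmodType K) (pi : representation A E),
    alg_irreducible pi /\ J = repr_kernel pi.

Definition selfadjoint (R : realType) (S : dynamical_system) (J : set (ell1 R S)) :=
  @ell1_star R S @` J = J.

(* Main.v *)
Require Import Defs.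
From HB Require Import structures.
From mathcomp Require Import all_boot all_order all_algebra.
From mathcomp Require Import finmap all_classical all_reals.
From mathcomp Require Import topology normedtype ereal esum.
From mathcomp Require Import cyclic separable cyclotomic.
From mathcomp Require Import complex ring lra zify.
From mathcomp Require summability sequences.

(* Let P be the kernel of an irreducible representation on E, and let the hull
   of P be the closed invariant set of common zeros of P and C(X).  As E is
   cyclic, a Neumann series argument shows that P is closed, so P contains
   every a whose coefficients all vanish on the hull.
   If, for each n != 0, the points of the hull that are moved by the n-th power
   of the homeomorphism are dense in the hull, then conversely the coefficients
   of the elements of P vanish on the hull, and this condition is selfadjoint.
   Otherwise the n-th power is the identity on a nonempty relatively open
   subset of the hull, and since P is a prime ideal the hull is a single finite
   orbit, of period p say.  Then delta^p acts on E as an endomorphism of the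
   module.  Such an endomorphism, being invertible with powers of norm at most
   1, is a scalar mu^p with |mu| = 1; this is Rickart's elementary proof that
   spectra are nonempty, applied to the quotient norm on E.  It follows that a
   lies in P if and only if the sums of mu^n a(n)(x) over the residue classes of
   n modulo p vanish for all x in the hull, which is again a selfadjoint
   condition because the conjugate of mu is its inverse. *)

Set Implicit Arguments.
Unset Strict Implicit.
Unset Printing Implicit Defensive.
Import Order.TTheory GRing.Theory Num.Theory numFieldNormedType.Exports.
Import ComplexField.Normc.
Local Open Scope classical_set_scope.
Local Open Scope ring_scope.
Local Open Scope complex_scope.

(** * The Banach algebra norm and Neumann series *)

Section Sums.
Context (R : realType).
Local Notation C := R[i].

Lemma normcX (z : C) n : normc (z ^+ n) = normc z ^+ n.
Proof. by elim: n => [|n IH]; rewrite ?expr0 ?normc1// !exprS normcM IH. Qed.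

Lemma sums_le_pair_dep (I J : choiceType) (M : I -> R) (N : I -> J -> R) T :
  (forall i j, 0 <= N i j) -> sums_le M T -> (forall i, sums_le (N i) (M i)) ->
  sums_le (fun p : I * J => N p.1 p.2) T.
Proof.
move=> N0 MT NM A; pose A1 := [fset p.1 | p in A]%fset.
pose A2 := [fset p.2 | p in A]%fset.
apply: (@le_trans _ _ (\sum_(p <- (A1 `*` A2)%fset) N p.1 p.2)).
  apply: ler_sum_fset => [p|]; first exact: N0.
  by apply/fsubsetP => p pA; rewrite inE !in_imfset.
rewrite (perm_big _ (enum_imfset2 _ _))/=; last first.
  by move=> [? ?] [? ?] _ _ /= [-> ->].
rewrite big_allpairs_dep/=; apply: le_trans (MT A1).
by apply: ler_sum => i _; exact: NM.
Qed.

(** Once the partial sum over [A] is within [e] of the supremum [s] of all partial sums, the terms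
    outside a larger [B] can add at most [e]. *)
Lemma sums_le_tail (I : choiceType) (M : I -> R) T :
  (forall i, 0 <= M i) -> sums_le M T ->
  forall e : R, 0 < e -> exists A : {fset I}, forall B : {fset I},
    (A `<=` B)%fset -> sums_le (fun i => if i \in B then 0 else M i) e.
Proof.
move=> M0 MT e e0; have [s Ms sM] := sums_le_sup M0 MT.
have [A sA] := sM _ e0; exists A => B /sA sB D.
have := Ms (B `|` D)%fset; rewrite (big_fsetID _ (fun i => i \in B))/=.
rewrite (_ : [fset x in B `|` D | x \in B]%fset = B); last first.
  by apply/fsetP => i; rewrite !inE/= andb_idl// => ->.
rewrite (_ : [fset x in B `|` D | x \notin B]%fset = [fset x in D | x \notin B]%fset); last first.
  by apply/fsetP => i; rewrite !inE/=; case: (i \in B); rewrite ?andbF ?andbT.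
rewrite -big_fset_condE [X in _ + X]big_mkcond/= => H.
rewrite (eq_bigr (fun i => if i \notin B then M i else 0)); last first.
  by move=> i _; case: (i \in B).
lra.
Qed.

Lemma sums_le_single (I : choiceType) (j : I) (t : R) : 0 <= t ->
  sums_le (fun i => if i == j then t else 0) t.
Proof.
move=> t0 A; rewrite -big_mkcond/= big_fset_condE.
apply: (@le_trans _ _ (\sum_(i <- [fset j]%fset) t)).
  apply: ler_sum_fset => //; apply/fsubsetP => i.
  by rewrite !inE/= => /andP[_].
by rewrite big_seq_fset1.
Qed.

Lemma has_sum_fset (I : choiceType) (f : I -> C) (A : {fset I}) :
  has_sum (fun i => if i \in A then f i else 0) (\sum_(i <- A) f i).
Proof.
move=> e e0; exists A => B AB.
rewrite (big_fsetID _ (fun i => i \in A) B)/=.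
rewrite (_ : [fset x in B | x \in A]%fset = A); last first.
  by apply/fsetP => i; rewrite !inE/= andb_idl// => /(fsubsetP AB).
rewrite [X in _ + X - _]big1_fset ?addr0; last first.
  by move=> i; rewrite !inE => /andP[_ /negPf ->].
rewrite (_ : (\sum_(i <- A) (if i \in A then f i else 0)) = \sum_(i <- A) f i).
  by rewrite subrr normc0.
by apply: eq_big_seq => i ->.
Qed.

Lemma fset_nat_sub (A : {fset nat}) :
  exists K, (A `<=` [fset k in iota 0 K])%fset.
Proof.
have [K AK] : exists K, forall k, k \in A -> (k < K)%N.
  exists (\max_(k <- A) k).+1 => k kA; rewrite ltnS.
  exact: (@leq_bigmax_seq _ (enum_fset A) xpredT (fun i => i) k kA isT).
by exists K; apply/fsubsetP => k /AK kK; rewrite !inE/= mem_iota.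
Qed.

Lemma big_fset_iota (V : nmodType) (F : nat -> V) K :
  \sum_(k <- [fset k in iota 0 K]%fset) F k = \sum_(k < K) F k.
Proof.
rewrite (perm_big (iota 0 K)); last first.
  by apply: uniq_perm; rewrite ?iota_uniq ?fset_uniq// => k; rewrite !inE.
have -> : iota 0 K = index_iota 0 K by rewrite /index_iota subn0.
by rewrite big_mkord.
Qed.

End Sums.

(** * The norm of [ell1]: submultiplicativity, completeness, Neumann series *)

Section Norm.
Context (R : realType) (S : dynamical_system).
Local Notation C := R[i].
Local Notation ell1 := (ell1 R S).
Implicit Types (a b c : ell1).

Lemma nrm1_le a (M : int -> R) T :
  (forall n x, normc (a n x) <= M n) -> sums_le M T -> nrm1 a <= T.
Proof.
move=> aM MT; rewrite -lee_fin /nrm1 fineK; last first.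
  rewrite ge0_fin_numE; last by apply: esum_ge0 => n _; exact: supnorm_ell1_ge0.
  exact: ell1_summable.
apply: le_trans (esum_sums_le MT); apply: le_esum => n _.
by apply: supnorm_le => x; rewrite lee_fin.
Qed.

(** Each coefficient is bounded by the sum of the [N i n] over [i], and interchanging the two
    summations gives [T]. It is stated for a bare [f] so that it can also prove that [f] lies in
    [ell1]. *)
Lemma esum_dominated (I : choiceType) (f : int -> S -> C)
    (F : I -> int -> S -> C) (N : I -> int -> R) T :
  (forall n x, has_sum (fun i => F i n x) (f n x)) ->
  (forall i n x, normc (F i n x) <= N i n) ->
  sums_le (fun p : I * int => N p.1 p.2) T ->
  (ell1_norm f <= T%:E)%E.
Proof.
move=> Ff FN NT.
have [x0 _] := ds_nonempty S.
have N0 i n : 0 <= N i n by apply: le_trans (FN i n x0); exact: normc_ge0.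
have NnT n : sums_le (N^~ n) T.
  move=> A; have := NT [fset (i, n) | i in A]%fset.
  by rewrite big_imfset//= => ? ? _ _ [].
pose L n := (\esum_(k in [set: I]) (N k n)%:E)%E.
apply: (@le_trans _ _ (\esum_(n in [set: int]) L n)%E).
  apply: le_esum => n _.
  have L0 : (0 <= L n)%E by apply: esum_ge0 => k _; rewrite lee_fin.
  have Lfin : L n \is a fin_num.
    rewrite ge0_fin_numE//.
    by apply: le_lt_trans (esum_sums_le (NnT n)) _; exact: ltry.
  apply: supnorm_le => x; rewrite -(fineK Lfin) lee_fin.
  apply: has_sum_le (Ff n x); first by move=> i; exact: FN.
  by apply: sums_le_esum => //; rewrite -ge0_fin_numE.
rewrite esum_esum; last by move=> n k _ _; rewrite lee_fin.
rewrite (_ : [set: int] `*`` _ = setT); last by apply/seteqP; split=> -[].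
apply: esum_sums_le.
by apply: (@sums_le_bij _ _ _ (fun p : int * I => (p.2, p.1))
  (fun p => (p.2, p.1)) _ _ _ NT); case.
Qed.

Lemma nrm1_dominated (I : choiceType) a (F : I -> int -> S -> C)
    (N : I -> int -> R) T :
  (forall n x, has_sum (fun i => F i n x) (a n x)) ->
  (forall i n x, normc (F i n x) <= N i n) ->
  sums_le (fun p : I * int => N p.1 p.2) T ->
  nrm1 a <= T.
Proof.
move=> Fa FN NT; rewrite -lee_fin /nrm1 fineK; first exact: esum_dominated NT.
rewrite ge0_fin_numE; last by apply: esum_ge0 => n _; exact: supnorm_ell1_ge0.
exact: ell1_summable.
Qed.

Lemma nrm1D a b : nrm1 (a + b) <= nrm1 a + nrm1 b.
Proof.
apply: (@nrm1_le _ (fun n => nrm a n + nrm b n)) => [n x|A].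
  by apply: (le_trans (le_normcD _ _)); rewrite lerD// nrm_ge.
by rewrite big_split lerD// nrm_sums.
Qed.

Lemma nrm1Z z a : nrm1 (z *: a) <= normc z * nrm1 a.
Proof.
apply: (@nrm1_le _ (fun n => normc z * nrm a n)) => [n x|A].
  by rewrite normcM ler_wpM2l ?normc_ge0 ?nrm_ge.
by rewrite -mulr_sumr ler_wpM2l ?normc_ge0 ?nrm_sums.
Qed.

Lemma nrm1N a : nrm1 (- a) <= nrm1 a.
Proof. by apply: nrm1_le (nrm_sums a) => n x; rewrite normcN nrm_ge. Qed.

Lemma nrm1M a b : nrm1 (a * b) <= nrm1 a * nrm1 b.
Proof.
apply: (@nrm1_dominated _ _ (fun k n x => a k x * b (n - k) (sigz k x))
  (fun k n => nrm a k * nrm b (n - k))).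
- by move=> n x; exact: conv_has_sum.
- by move=> k n x; rewrite -alphazE conv_term_le.
- apply: (@sums_le_pair R int int (nrm a) (fun k n => nrm b (n - k))) => //.
  + exact: nrm_ge0.
  + by move=> i j; exact: nrm_ge0.
  + exact: nrm1_ge0.
  + exact: nrm_sums.
  + by move=> i; exact: nrm_shift_sums.
Qed.


Lemma nrm1_eq0 a : nrm1 a <= 0 -> a = 0.
Proof.
move=> a0; apply: ell1P => n x; apply: eq0_normc; apply/eqP.
by rewrite eq_le normc_ge0 (le_trans (nrm_ge _ _ _))// (le_trans (nrm_le _ _)).
Qed.

Lemma nrm1_one : nrm1 (1 : ell1) <= 1.
Proof.
apply: nrm1_le (sums_le_single (0 : int) ler01) => n x.
by rewrite /= /Defs.one_fun; case: (n == 0); rewrite ?normc0 ?normc1.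
Qed.

Lemma nrm10 : nrm1 (0 : ell1) = 0.
Proof.
apply/eqP; rewrite eq_le nrm1_ge0 andbT.
apply: (@nrm1_le _ (fun=> 0)) => [n x|A]; first by rewrite normc0.
by rewrite big1.
Qed.

Lemma ell1_sumE (I : Type) (s : seq I) (v : I -> ell1) n x :
  (\sum_(i <- s) v i) n x = \sum_(i <- s) v i n x.
Proof. exact: (big_morph (fun a : ell1 => a n x)). Qed.

(** Completeness in series form: an absolutely convergent series is summed pointwise, and its
    remainders are controlled by the tails of the sum of norms. *)
Lemma ell1_series (I : choiceType) (v : I -> ell1) T :
  sums_le (fun i => nrm1 (v i)) T ->
  exists y : ell1, (forall n x, has_sum (fun i => v i n x) (y n x)) /\
    forall e : R, 0 < e -> exists A : {fset I}, forall B : {fset I},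
      (A `<=` B)%fset -> nrm1 (y - \sum_(i <- B) v i) <= e.
Proof.
move=> vT.
pose f (n : int) := unif_sum (fun i x => v i n x).
have nT n : sums_le (fun i => nrm (v i) n) T.
  by apply: sums_le_sub vT => i; exact: nrm_le.
have fs n x : has_sum (fun i => v i n x) (f n x).
  by have [_] := unif_sumP (fun i => nrm_ge (v i) n) (nT n); exact.
have fc n : continuous (f n).
  apply: continuous_unif_sum (fun i => nrm_ge (v i) n) (nT n) _ => i.
  exact: ell1_continuous.
have fsum : (ell1_norm f < +oo)%E.
  apply: le_lt_trans (ltry T).
  apply: (esum_dominated fs (N := fun i n => nrm (v i) n)).
    by move=> i n x; exact: nrm_ge.
  apply: (@sums_le_pair_dep _ _ _ _ (fun i n => nrm (v i) n) _ _ vT).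
    by move=> i n; exact: nrm_ge0.
  by move=> i; exact: nrm_sums.
exists (Ell1 fc fsum); split=> // e e0.
have [A AE] := sums_le_tail (fun i => nrm1_ge0 (v i)) vT e0.
exists A => B /AE Be.
apply: (@nrm1_dominated _ _ (fun i n x => if i \in B then 0 else v i n x)
  (fun i n => if i \in B then 0 else nrm (v i) n)).
- move=> n x; have := has_sum_lin (-1) (has_sum_fset (fun i => v i n x) B) (fs n x).
  rewrite /= ell1_sumE mulN1r addrC; congr has_sum; apply/funext => i.
  by case: ifP => _; rewrite mulN1r ?addNr// oppr0 add0r.
- by move=> i n x; case: ifP => _; rewrite ?normc0 ?nrm_ge.
- apply: (@sums_le_pair_dep _ _ _ _
    (fun i n => if i \in B then 0 else nrm (v i) n) _ _ Be) => [i n|i];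
    case: ifP => _ //.
  + exact: nrm_ge0.
  + by move=> ?; rewrite big1.
  + exact: nrm_sums.
Qed.

Lemma nrm1X a k : nrm1 (a ^+ k) <= nrm1 a ^+ k.
Proof.
elim: k => [|k IH]; first by rewrite !expr0 nrm1_one.
rewrite !exprS; apply: (le_trans (nrm1M _ _)).
by rewrite ler_wpM2l ?nrm1_ge0.
Qed.

Lemma geometric_sums (t : R) : 0 <= t -> t < 1 ->
  sums_le (fun k : nat => t ^+ k) (1 - t)^-1.
Proof.
move=> t0 t1 A; have [K AK] := fset_nat_sub A.
apply: (@le_trans _ _ (\sum_(k <- [fset k in iota 0 K]%fset) t ^+ k)).
  by apply: ler_sum_fset => // k; exact: exprn_ge0.
have -> : \sum_(k <- [fset k in iota 0 K]%fset) t ^+ k = (1 - t ^+ K) / (1 - t).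
  have -> : 1 - t ^+ K = (1 - t) * \sum_(i < K) t ^+ i.
    rewrite -{1}(expr1n _ K) subrXX; congr (_ * _).
    by apply: eq_bigr => i _; rewrite expr1n mul1r.
  by rewrite big_fset_iota mulrAC mulfV ?gt_eqF ?subr_gt0// mul1r.
rewrite ler_pdivrMr ?subr_gt0// mulVf ?gt_eqF ?subr_gt0//.
by rewrite lerBlDr lerDl exprn_ge0.
Qed.

Lemma nrm1_small0 a : (forall e : R, 0 < e -> nrm1 a <= e) -> a = 0.
Proof. by move=> H; apply: nrm1_eq0; apply/ler_addgt0Pr => e /H; rewrite add0r. Qed.

Lemma neumann a : nrm1 a < 1 -> exists y : ell1, (1 - a) * y = 1 /\ y * (1 - a) = 1.
Proof.
move=> a1.
have vT : sums_le (fun k : nat => nrm1 (a ^+ k)) (1 - nrm1 a)^-1.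
  by apply: sums_le_sub (geometric_sums (nrm1_ge0 a) a1) => k; exact: nrm1X.
have [y [_ ay]] := ell1_series vT.
(* One [k] serves both purposes: the partial sum is near [y], and the error term [a ^+ k] of the
   finite geometric identity is small. *)
have approx e : 0 < e -> exists k, nrm1 (y - \sum_(i < k) a ^+ i) <= e /\ nrm1 (a ^+ k) <= e.
  move=> e0; have [A yA] := ay _ e0.
  have [D De] := sums_le_tail (fun i => nrm1_ge0 (a ^+ i)) vT e0.
  have [K AK] := fset_nat_sub (A `|` D)%fset.
  move: AK; rewrite !fsubUset => /andP[AK DK].
  exists K; split; first by have := yA _ AK; rewrite big_fset_iota.
  have := De _ DK [fset K]%fset; rewrite big_seq_fset1 ifF//.
  by rewrite !inE/= mem_iota/= ltnn.
have geo k : (1 - a) * \sum_(i < k) a ^+ i = 1 - a ^+ k.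
  rewrite -{2}(expr1n _ k) subrXX_comm; last exact: commr_sym (commr1 _).
  by congr (_ * _); apply: eq_bigr => i _; rewrite expr1n mul1r.
have geo' k : (\sum_(i < k) a ^+ i) * (1 - a) = 1 - a ^+ k.
  rewrite -geo; apply: commr_sym; apply: commr_sum => i _.
  by apply: commrX; apply: commr_sym; apply: commrB; [exact: commr1|].
have b0 : 0 < nrm1 (1 - a) + 1 by rewrite ltr_wpDl ?nrm1_ge0.
exists y; split; apply/subr0_eq/nrm1_small0 => e e0.
  have d0 : 0 < e / (nrm1 (1 - a) + 1) by rewrite divr_gt0.
  have [k [yk ak]] := approx _ d0.
  have -> : (1 - a) * y - 1 = (1 - a) * (y - \sum_(i < k) a ^+ i) - a ^+ k.
    by rewrite mulrBr geo opprB addrAC -addrA addKr.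
  apply: (le_trans (nrm1D _ _)); apply: (le_trans (lerD (nrm1M _ _) (nrm1N _))).
  have := ler_wpM2l (nrm1_ge0 (1 - a)) yk.
  have : e = nrm1 (1 - a) * (e / (nrm1 (1 - a) + 1)) + e / (nrm1 (1 - a) + 1).
    by rewrite -[X in _ + X]mul1r -mulrDl mulrC divfK// gt_eqF.
  lra.
have d0 : 0 < e / (nrm1 (1 - a) + 1) by rewrite divr_gt0.
have [k [yk ak]] := approx _ d0.
have -> : y * (1 - a) - 1 = (y - \sum_(i < k) a ^+ i) * (1 - a) - a ^+ k.
  by rewrite mulrBl geo' opprB addrAC -addrA addKr.
apply: (le_trans (nrm1D _ _)); apply: (le_trans (lerD (nrm1M _ _) (nrm1N _))).
have := ler_wpM2r (nrm1_ge0 (1 - a)) yk.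
have : e = e / (nrm1 (1 - a) + 1) * nrm1 (1 - a) + e / (nrm1 (1 - a) + 1).
  by rewrite -[X in _ + X]mulr1 -mulrDr divfK// gt_eqF.
lra.
Qed.

End Norm.

(** * Continuous functions and single-coefficient elements *)

Section Continuity.
Context (R : realType) (X : topologicalType).
Local Notation C := R[i].
Implicit Types (f g : X -> C) (u : X -> R).

Lemma continuous_realc u : continuous u -> continuous (fun x => (u x)%:C : C).
Proof.
move=> uc; apply/continuousPc => x e e0.
have /cvgrPdist_lt/(_ e e0) := uc x; apply: filterS => y.
by rewrite -rmorphB normc_real.
Qed.

Lemma continuous_normc f : continuous f -> continuous (fun x => normc (f x)).
Proof.
move=> /continuousPc fc x; apply/cvgrPdist_lt => e e0.
have := fc x e e0; apply: filterS => y; apply: le_lt_trans.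
rewrite ler_norml; have := le_normcD (f x - f y) (f y); rewrite subrK.
have := le_normcD (f y - f x) (f x); rewrite subrK (normcB (f y)); lra.
Qed.

Lemma continuous_conjc f : continuous f -> continuous (fun x => (f x)^*).
Proof.
move=> /continuousPc fc; apply/continuousPc => x e e0.
have := fc x e e0; apply: filterS => y; rewrite -rmorphB.
by case: (_ - _) => u v /=; rewrite sqrrN.
Qed.

Lemma continuous_mulc f g : continuous f -> continuous g ->
  continuous (fun x => f x * g x).
Proof. by move=> fc gc x; apply: (@cvgM R[i] _ _ _ f g); [exact: fc|exact: gc]. Qed.

Lemma normc_conj (z : C) : normc z^* = normc z.
Proof. by case: z => u v /=; rewrite sqrrN. Qed.

Lemma mul_conjc (z : C) : z^* * z = (normc z ^+ 2)%:C.
Proof.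
case: z => u v /=; rewrite sqr_sqrtr ?addr_ge0 ?sqr_ge0//.
by apply/eqP; rewrite eq_complex/=; apply/andP; split; apply/eqP; ring.
Qed.

(** The cut-off at [c] yields a globally continuous function that agrees with the inverse of [u]
    where [u] is at least [c]. *)
Lemma continuous_divmax u (c : R) : 0 < c -> continuous u ->
  continuous (fun x => (Order.max (u x) c)^-1).
Proof.
move=> c0 uc x; apply: (@continuousV R X (fun x => Order.max (u x) c)).
  by rewrite gt_eqF// lt_max c0 orbT.
apply: (@continuous_max R X u (cst c)); [exact: uc|exact: cvg_cst].
Qed.

End Continuity.

(** * Separation of points and of their translates *)

Section Urysohn.
Context (R : realType) (S : dynamical_system).

Lemma urysohn_point (x : S) (V : set S) : open V -> V x ->
  exists f : S -> R, [/\ continuous f, f x = 1, forall y, 0 <= f y <= 1 &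
    forall y, ~ V y -> f y = 0].
Proof.
move=> Vo Vx; have hS := @ds_hausdorff S.
have nS : normal_space S by apply: compact_normal => //; exact: ds_compact.
have /normal_separatorP H := nS.
have /(@uniform_separatorP _ R)[f [fc f01 fV fx]] : uniform_separator (~` V) [set x].
  apply: (H R); first exact: open_closedC.
  - exact/accessible_closed_set1/hausdorff_accessible.
  - by apply/seteqP; split=> // y [/= + yx]; rewrite yx.
exists f; split=> //.
- exact: (fx (f x) (ex_intro2 _ _ x erefl erefl)).
- by move=> y; have /= := f01 (f y) (ex_intro2 _ _ y Logic.I erefl); rewrite in_itv.
- by move=> y Vy; exact: (fV (f y) (ex_intro2 _ _ y Vy erefl)).
Qed.

Lemma hausdorff_separate (x y : S) : x <> y ->
  exists A B : set S, [/\ open A, open B, A x, B y & forall z, A z -> B z -> False].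
Proof.
move=> xy; have := @ds_hausdorff S; rewrite open_hausdorff => /(_ x y).
have /eqP xy' := xy; move=> /(_ xy')[[A B]]/= [xA yB] [Ao Bo /eqP AB].
exists A, B; split=> //; [by rewrite inE in xA|by rewrite inE in yB|].
by move=> z Az Bz; have : (A `&` B) z by []; rewrite AB.
Qed.

Lemma open_sigz k (V : set S) : open V -> open (sigz k @^-1` V).
Proof. by move=> Vo; apply: open_comp => // x _; exact: sigz_continuous. Qed.

Lemma open_moved k : open [set x : S | sigz k x <> x].
Proof.
rewrite openE => x /= kx.
have [A [B [Ao Bo Ax Bx AB]]] := hausdorff_separate kx.
rewrite /interior/= nbhsE; exists (sigz k @^-1` A `&` B).
  by split=> //; apply: openI => //; exact: open_sigz.
by move=> y [/= Ay By] ky; rewrite ky in Ay; exact: AB By.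
Qed.

(** For each [k] in [s], separate [x] from its translate and pull the second neighbourhood back by
    [sigz k]; finitely many intersections remain open. *)
Lemma wandering_nbhd (s : seq int) (x : S) : (forall k, k \in s -> sigz k x <> x) ->
  exists V : set S, [/\ open V, V x &
    forall k y, k \in s -> V y -> V (sigz k y) -> False].
Proof.
elim: s => [|k s IH] sx; first by exists setT; split=> //; exact: openT.
have [|V [Vo Vx VV]] := IH; first by move=> j js; apply: sx; rewrite inE js orbT.
have kx : sigz k x <> x by apply: sx; rewrite inE eqxx.
have [A [B [Ao Bo Ax Bx AB]]] := hausdorff_separate kx.
exists (V `&` (sigz k @^-1` A `&` B)); split=> //.
  by apply: openI => //; apply: openI => //; exact: open_sigz.
move=> j y; rewrite inE => /orP[/eqP ->|js] [Vy [/= Ay By]] [Vjy [_ Bjy]].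
  exact: AB Ay Bjy.
exact: VV js Vy Vjy.
Qed.

End Urysohn.

Section Mono.
Context (R : realType) (S : dynamical_system).
Local Notation C := R[i].
Local Notation ell1 := (ell1 R S).
Implicit Types (a b c : ell1) (f : S -> C).

(** The monomial f δ^m, where δ is the canonical unitary [delta 1]; the case [m = 0] embeds C(X). *)
Definition mono_fun m f (n : int) : S -> C := fun x => if n == m then f x else 0.

Lemma mono_continuous m f (fc : continuous f) n : continuous (mono_fun m f n).
Proof. by rewrite /mono_fun; case: eqP => _ //; move=> x; exact: cvg_cst. Qed.

Lemma normc_bounded f : continuous f -> exists2 M : R, 0 <= M & forall x, normc (f x) <= M.
Proof.
move=> /continuous_normc fc.
have := @continuous_compact _ _ (fun x => normc (f x)) [set: S] _ (@ds_compact S).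
move=> /(_ (continuous_subspaceT fc))/compact_bounded[M [_ HM]].
exists (`|M| + 1); first by rewrite addr_ge0.
have Mlt : M < `|M| + 1 by rewrite ltr_pwDr// ler_norm.
move=> x; have /= := HM _ Mlt (normc (f x)) (ex_intro2 _ _ x Logic.I erefl).
by rewrite ger0_norm ?normc_ge0.
Qed.

Lemma mono_summable m f (fc : continuous f) :
  (\esum_(n in [set: int]) supnorm (mono_fun m f n) < +oo)%E.
Proof.
have [M M0 fM] := normc_bounded fc.
apply: ell1_summable_intro (sums_le_single m M0) => n x.
by rewrite /mono_fun; case: (n == m); rewrite ?normc0.
Qed.

Definition mono m f (fc : continuous f) : ell1 :=
  Ell1 (@mono_continuous m f fc) (@mono_summable m f fc).

Lemma monoE m f (fc : continuous f) n x :
  mono m fc n x = if n == m then f x else 0.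
Proof. by []. Qed.

Lemma nrm1_mono m f (fc : continuous f) (t : R) :
  (forall x, normc (f x) <= t) -> nrm1 (mono m fc) <= t.
Proof.
move=> ft; have [x0 _] := ds_nonempty S.
have t0 : 0 <= t by apply: le_trans (ft x0); exact: normc_ge0.
apply: nrm1_le (sums_le_single m t0) => n x.
by rewrite monoE; case: (n == m); rewrite ?normc0.
Qed.

Lemma mono_mulE m f (fc : continuous f) a n x :
  (mono m fc * a) n x = f x * a (n - m) (sigz m x).
Proof.
apply: (has_sum_unique (conv_has_sum (mono m fc) a n x)).
have := has_sum1 m (f x * a (n - m) (sigz m x)).
congr has_sum; apply/funext => k; rewrite monoE.
by case: eqP => [->//|_]; rewrite mul0r.
Qed.

Lemma mul_monoE m f (fc : continuous f) a n x :
  (a * mono m fc) n x = a (n - m) x * f (sigz (n - m) x).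
Proof.
apply: (has_sum_unique (conv_has_sum a (mono m fc) n x)).
have := has_sum1 (n - m) (a (n - m) x * f (sigz (n - m) x)).
congr has_sum; apply/funext => k; rewrite monoE.
have -> : (n - k == m) = (k == n - m) by apply/eqP/eqP => [<-|->]; ring.
by case: eqP => [->//|_]; rewrite mulr0.
Qed.

Lemma continuous_one : continuous (fun _ : S => 1 : C).
Proof. by move=> x; exact: cvg_cst. Qed.

Definition delta n : ell1 := mono n continuous_one.

Lemma delta_mulE m a n x : (delta m * a) n x = a (n - m) (sigz m x).
Proof. by rewrite mono_mulE mul1r. Qed.

Lemma mul_deltaE m a n x : (a * delta m) n x = a (n - m) x.
Proof. by rewrite mul_monoE mulr1. Qed.

Lemma deltaD m n : delta (m + n) = delta m * delta n.
Proof.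
apply: ell1P => k x; rewrite delta_mulE !monoE.
by have -> : (k - m == n) = (k == m + n) by apply/eqP/eqP => [<-|->]; ring.
Qed.

Lemma delta0 : delta 0 = 1.
Proof. by apply: ell1P => n x. Qed.

Lemma nrm1_delta n : nrm1 (delta n) <= 1.
Proof. by apply: nrm1_mono => x; rewrite normc1. Qed.

Definition tail_fun (A : {fset int}) a (n : int) : S -> C :=
  if n \in A then fun=> 0 else a n.

Lemma tail_continuous A a n : continuous (tail_fun A a n).
Proof.
rewrite /tail_fun; case: ifP => _; last exact: ell1_continuous.
by move=> x; exact: cvg_cst.
Qed.

Lemma tail_summable A a : (\esum_(n in [set: int]) supnorm (tail_fun A a n) < +oo)%E.
Proof.
apply: ell1_summable_intro (nrm_sums a) => n x.
by rewrite /tail_fun; case: ifP => _; rewrite ?normc0 ?nrm_ge0 ?nrm_ge.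
Qed.

Definition tail A a : ell1 := Ell1 (@tail_continuous A a) (@tail_summable A a).

Lemma tailE A a n x : tail A a n x = if n \in A then 0 else a n x.
Proof. by rewrite /= /tail_fun; case: ifP. Qed.

Lemma nrm1_tail a (e : R) : 0 < e -> exists A : {fset int}, forall B,
  (A `<=` B)%fset -> nrm1 (tail B a) <= e.
Proof.
move=> e0; have [A AB] := sums_le_tail (nrm_ge0 a) (nrm_sums a) e0.
exists A => B /AB; apply: nrm1_le => n x; rewrite tailE.
by case: ifP => _; rewrite ?normc0 ?nrm_ge.
Qed.

End Mono.

(** * Hulls of ideals *)

Lemma open_forall_seq (X : topologicalType) (I : eqType) (s : seq I) (U : I -> set X) :
  (forall i, open (U i)) -> open [set x | forall i, i \in s -> U i x].
Proof.
move=> Uo; elim: s => [|i s IH].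
  rewrite (_ : [set _ | _] = setT); first exact: openT.
  by apply/seteqP; split.
rewrite (_ : [set _ | _] = U i `&` [set x | forall i, i \in s -> U i x]).
  exact: openI.
apply/seteqP; split=> x /=.
  by move=> H; split=> [|j js]; apply: H; rewrite inE ?eqxx// js orbT.
by move=> [Ui H] j; rewrite inE => /orP[/eqP ->|/H].
Qed.

(** Compactness is used in its near-covering form, along the filter of finite sets [D] of centres:
    the neighbourhood [U x] is covered by every [D] that contains [x]. *)
Lemma finite_neighbourhood_cover (X : topologicalType) (K : set X) (U : X -> set X) :
  compact K -> (forall y, open (U y)) -> (forall y, U y y) ->
  exists D : {fset X}, forall x, K x -> exists2 y, y \in D & U y x.
Proof.
move=> /compact_near_coveringP Kc Uo Uy.
have [|D _ DK] := Kc _ (@summability.totally X)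
  (fun (D : {fset X}) x => exists2 y, y \in D & U y x) (@summability.totally_filter X).
  move=> x Kx; exists (U x, [set D | [fset x]%fset `<=` D]%fset) => /=.
    by split; [apply: open_nbhs_nbhs|exists [fset x]%fset].
  by move=> [y D]/= [Uxy]; rewrite fsub1set => xD; exists x.
by exists D => x Kx; exact: DK (fsubset_refl _) _ Kx.
Qed.

Section Hull.
Context (R : realType) (S : dynamical_system).
Local Notation C := R[i].
Local Notation ell1 := (ell1 R S).
Implicit Types (a b c p : ell1) (f : S -> C).

Definition is_ideal (P : set ell1) := [/\ P 0, forall a b, P a -> P b -> P (a + b),
  forall a b, P b -> P (a * b) & forall a b, P a -> P (a * b)].

Definition hull (P : set ell1) : set S :=
  [set x | forall f (fc : continuous f), P (mono 0 fc) -> f x = 0].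

Context (P : set ell1) (idP : is_ideal P).

(** Conjugation by [delta k] turns [f] into its composite with [sigz k], which therefore stays in
    the ideal. *)
Lemma hull_sigz k x : hull P x -> hull P (sigz k x).
Proof.
have [_ _ Pl Pr] := idP.
move=> Px f fc Pf.
have gc : continuous (fun y => f (sigz k y)).
  by move=> y; apply: continuous_comp; [exact: sigz_continuous|exact: fc].
apply: (Px _ gc); have := Pr _ (delta R S (- k)) (Pl (delta R S k) _ Pf).
congr P; apply: ell1P => n y; rewrite mul_deltaE delta_mulE !monoE opprK.
by rewrite addrK.
Qed.

Lemma open_normc_lt f (t : R) : continuous f -> open [set x | normc (f x) < t].
Proof.
move=> /continuous_normc fc.
by apply: (@open_comp _ _ _ [set y | y < t]) => [x _|]; [exact: fc|exact: open_lt].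
Qed.

Lemma open_normc_gt f (t : R) : continuous f -> open [set x | t < normc (f x)].
Proof.
move=> /continuous_normc fc.
by apply: (@open_comp _ _ _ [set y | t < y]) => [x _|]; [exact: fc|exact: open_gt].
Qed.

(** The continuity proof is bound inside because [mono] takes it as an argument. *)
Definition real_in_ideal (F : S -> R) :=
  exists Fc : continuous F, P (mono 0 (continuous_realc Fc)).

Lemma real_in_ideal_mul (F G : S -> R) :
  continuous F -> real_in_ideal G -> real_in_ideal (fun x => F x * G x).
Proof.
have [_ _ Pl _] := idP.
move=> Fc [Gc PG].
have FGc : continuous (fun x => F x * G x).
  by move=> x; apply: continuousM; [exact: Fc|exact: Gc].
exists FGc; have := Pl (mono 0 (continuous_realc Fc)) _ PG; congr P.
apply: ell1P => n x; rewrite mono_mulE !monoE subr0 sigz0.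
by case: (n == 0); rewrite ?mulr0// rmorphM.
Qed.

Lemma real_in_ideal0 : real_in_ideal (fun=> 0).
Proof.
have [P0 _ _ _] := idP.
have zc : continuous (fun x : S => 0 : R) by move=> x; exact: cvg_cst.
exists zc; move: P0; congr P; apply: ell1P => n x.
by rewrite monoE; case: (n == 0).
Qed.

Lemma real_in_ideal_sum (s : seq S) (F : S -> S -> R) :
  (forall y, real_in_ideal (F y)) -> real_in_ideal (fun x => \sum_(y <- s) F y x).
Proof.
have [P0 PD _ _] := idP.
move=> PF; elim: s => [|y s [sc Ps]].
  by under eq_fun do rewrite big_nil; exact: real_in_ideal0.
have [yc Py] := PF y.
have ysc : continuous (fun x : S => \sum_(z <- y :: s) F z x).
  under eq_fun do rewrite big_cons.
  by move=> x; apply: (@continuousD R R^o); [exact: yc|exact: sc].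
exists ysc; have := PD _ _ Py Ps; congr P; apply: ell1P => n x /=.
by rewrite /mono_fun big_cons; case: (n == 0); rewrite ?addr0// rmorphD.
Qed.

(** If [f] in the ideal is nonzero at [x], its squared modulus is in the ideal as the product of [f]
    with its conjugate. It is scaled to take the value 2 at [x], so that it still exceeds 1
    nearby. *)
Lemma hullPn x : ~ hull P x ->
  exists F, [/\ real_in_ideal F, forall y, 0 <= F y & 1 < F x].
Proof.
have [_ _ Pl _] := idP.
move=> /existsNP[f /existsNP[fc /not_implyP[Pf fx]]].
have nfx : 0 < normc (f x).
  by rewrite lt_neqAle normc_ge0 andbT eq_sym; apply/eqP => /eq0_normc.
have Fc : continuous (fun y => normc (f y) * normc (f y)).
  have nc := continuous_normc fc.
  by move=> y; apply: (@continuousM R S (fun y => normc (f y)) (fun y => normc (f y)));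
     exact: nc.
exists (fun y => 2 / (normc (f x) * normc (f x)) * (normc (f y) * normc (f y))).
split; first last.
- by rewrite mulfVK ?gt_eqF ?mulr_gt0// ltr1n.
- by move=> y; rewrite !mulr_ge0 ?invr_ge0 ?mulr_ge0 ?normc_ge0.
apply: real_in_ideal_mul; first by move=> y; exact: cvg_cst.
exists Fc; have := Pl (mono 0 (continuous_conjc fc)) _ Pf; congr P.
apply: ell1P => n y; rewrite mono_mulE !monoE subr0 sigz0.
by case: (n == 0); rewrite ?mulr0// mul_conjc expr2.
Qed.

(* The approximants are [chi * a] with [chi = F / max(F, 1)], where [F] is a
   nonnegative function of the ideal that is at least 1 where one of finitely
   many large coefficients of [a] is not small. *)
Lemma vanishing_approx a (e : R) : (forall n x, hull P x -> a n x = 0) -> 0 < e ->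
  exists2 p, P p & nrm1 (a - p) <= e.
Proof.
have [_ _ Pl Pr] := idP.
move=> a0 e0; have e20 : 0 < e / 2 by rewrite divr_gt0.
have [A /(_ A (fsubset_refl _)) tA] := nrm1_tail a e20.
(* The coefficients with index in [A], each below [d], contribute at most [e / 2]; the added 1
   excludes a zero denominator. *)
pose d := e / 2 / (#|` A|%:R + 1).
have d0 : 0 < d by rewrite divr_gt0// ltr_wpDl.
(* Off the hull some function of the ideal exceeds 1 near [y]; on the hull the coefficients with
   index in [A] are already small near [y], and the zero function suffices. *)
have /choice[FU HFU] y : exists FU : (S -> R) * set S,
    [/\ real_in_ideal FU.1, forall x, 0 <= FU.1 x, open FU.2, FU.2 y &
    forall x, FU.2 x -> 1 <= FU.1 x \/ forall n, n \in enum_fset A -> normc (a n x) < d].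
  have [Py|Py] := pselect (hull P y); last first.
    have [F [PF F0 F1]] := hullPn Py; have [Fc _] := PF.
    exists (F, [set x | 1 < F x]); split=> //=.
      by apply: (@open_comp _ _ _ [set y : R | 1 < y]) => [x _|]; [exact: Fc|exact: open_gt].
    by move=> x /ltW; left.
  exists (fun=> 0, [set x | forall n, n \in enum_fset A -> normc (a n x) < d]).
  split=> //=.
  - exact: real_in_ideal0.
  - apply: (@open_forall_seq S int (enum_fset A) (fun n => [set x | normc (a n x) < d])) => n.
    exact/open_normc_lt/ell1_continuous.
  - by move=> n _; rewrite a0// normc0.
  - by move=> x; right.
have [|||D DU] := @finite_neighbourhood_cover S [set: S] (fun y => (FU y).2).
- exact: ds_compact.
- by move=> y; have [] := HFU y.
- by move=> y; have [] := HFU y.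
pose F x := \sum_(y <- D) (FU y).1 x.
have PF : real_in_ideal F.
  by apply: real_in_ideal_sum => y; have [] := HFU y.
have [Fc _] := PF.
have F0 x : 0 <= F x by apply: sumr_ge0 => y _; have [] := HFU y.
have Fd x : F x < 1 -> forall n, n \in A -> normc (a n x) < d.
  move=> Fx n nA; have [y yD yx] := DU x Logic.I.
  have [_ _ _ _ /(_ x yx)[F1|]] := HFU y; last exact.
  suff : 1 <= F x by rewrite leNgt Fx.
  apply: (le_trans F1); rewrite /F (big_fsetD1 y)//= lerDl.
  by apply: sumr_ge0 => z _; have [] := HFU z.
have [Xc PX] := real_in_ideal_mul (continuous_divmax ltr01 Fc) PF.
exists (mono 0 (continuous_realc Xc) * a); first exact: Pr.
have sA : sums_le (fun n => if n \in A then d else 0) (e / 2).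
  move=> B; rewrite -big_mkcond/= big_fset_condE.
  apply: (@le_trans _ _ (\sum_(i <- A) d)).
    apply: ler_sum_fset; first by move=> _; exact: ltW.
    by apply/fsubsetP => i; rewrite !inE/= => /andP[].
  rewrite big_const_seq count_predT iter_addr_0 -[d *+ _]mulr_natl.
  rewrite /d mulrCA ler_piMr ?(ltW e20)//.
  by rewrite ler_pdivrMr ?ltr_wpDl// mul1r lerDl.
apply: (@nrm1_le _ _ _ (fun n => (if n \in A then d else 0) + nrm (tail A a) n)); last first.
  move=> B; rewrite big_split/= (splitr e) lerD//.
  exact: le_trans (nrm_sums _ _) tA.
move=> n x.
have -> : (a - mono 0 (continuous_realc Xc) * a) n x =
    (1 - (Order.max (F x) 1)^-1 * F x)%:C * a n x.
  rewrite [LHS]/= -/(mono 0 (continuous_realc Xc) * a).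
  have := mono_mulE 0 (continuous_realc Xc) a n x; rewrite subr0 sigz0 /= => ->.
  by rewrite rmorphB mulrBl mul1r.
rewrite normcM normc_real.
(* Where [F x >= 1] the remainder vanishes; elsewhere its factor is at most 1, and the coefficients
   with index in [A] are below [d]. *)
have [F1|F1] := leP 1 (F x).
  rewrite mulVf ?gt_eqF ?(lt_le_trans ltr01)// subrr normr0 mul0r.
  by rewrite addr_ge0 ?nrm_ge0//; case: ifP => // _; exact: ltW.
rewrite invr1 mul1r ger0_norm ?subr_ge0 ?(ltW F1)//.
have H : (1 - F x) * normc (a n x) <= normc (a n x).
  by rewrite ler_piMl ?normc_ge0// lerBlDr lerDl F0.
apply: (le_trans H); case: ifPn => [nA|nA].
  by rewrite ler_wpDr ?nrm_ge0//; exact/ltW/Fd.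
by rewrite add0r; have := nrm_ge (tail A a) n x; rewrite tailE (negPf nA).
Qed.

End Hull.

(** * Ideals for which every nonzero power moves a dense set of points of the hull *)

Section FreePoints.
Context (R : realType) (S : dynamical_system).
Local Notation C := R[i].
Local Notation ell1 := (ell1 R S).
Implicit Types (a b c p : ell1) (f : S -> C).
Context (P : set ell1) (idP : is_ideal P).
Context (moved : forall k, k != 0 -> forall (W : set S) y, open W -> W y ->
  hull P y -> exists z, [/\ W z, hull P z & sigz k z <> z]).

(** The points moved by a given power form an open set, so the powers can be treated one at a time,
    each inside the open set already obtained. *)
Lemma moved_seq (s : seq int) (W : set S) y : 0 \notin s -> open W -> W y ->
  hull P y -> exists z, [/\ W z, hull P z & forall k, k \in s -> sigz k z <> z].
Proof.
elim: s => [|k s IH] s0 Wo Wy Py; first by exists y; split.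
move: s0; rewrite inE negb_or eq_sym => /andP[k0 s0].
have [z [Wz Pz sz]] := IH s0 Wo Wy Py.
pose V := [set x : S | forall j, j \in s -> sigz j x <> x].
have Vo : open V.
  by apply: (@open_forall_seq S int s (fun j => [set x | sigz j x <> x])) => j;
     exact: open_moved.
have [z' [[Wz' Vz'] Pz' kz']] := moved k0 (openI Wo Vo) (conj Wz sz) Pz.
exists z'; split=> // j; rewrite inE => /orP[/eqP ->//|]; exact: Vz'.
Qed.

(* If [a 0 x != 0], scale [a] so that its coefficient at 0 is 1 near a point [z]
   of the hull close to [x], and compress it by a bump [E] at [z] whose support
   is disjoint from its first translates: only the coefficient at 0 and a tail
   of norm < 1 survive.  For [K] with [K E = K] this puts [K (1 + t)] in the
   ideal, hence [K], although [K] is 1 at [z]. *)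
Lemma ideal_coef0_vanishes a x : P a -> hull P x -> a 0 x = 0.
Proof.
have [_ _ Pl Pr] := idP.
move=> Pa Px; apply/eqP/negPn/negP => /eqP ax.
have c0 : 0 < normc (a 0 x).
  by rewrite lt_neqAle normc_ge0 andbT eq_sym; apply/eqP => /eq0_normc.
set c := normc (a 0 x) in c0.
have c4 : 0 < c / 4 by rewrite divr_gt0.
have c2 : 0 < c / 2 by rewrite divr_gt0.
have [A0 tA] := nrm1_tail a c4.
(* Adding 0 to the index set keeps the coefficient at 0 out of the tail. *)
pose A := (0 |` A0)%fset.
have {}tA : nrm1 (tail A a) <= c / 4 by apply: tA; exact: fsubsetUr.
have A0in : 0 \in A by rewrite !inE eqxx.
pose W := [set y | c / 2 < normc (a 0 y)].
have Wo : open W by apply: open_normc_gt; exact: ell1_continuous.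
pose s := [seq k <- enum_fset A | k != 0].
have s0 : 0 \notin s by rewrite mem_filter eqxx.
have Wx : W x by rewrite /W/= -/c; lra.
have [z [Wz Pz sz]] := moved_seq s0 Wo Wx Px.
have [V [Vo Vz VV]] := wandering_nbhd sz.
have [f [fc fz f01 fVW]] := urysohn_point R (openI Vo Wo) (conj Vz Wz).
(* Where [k] is nonzero one has [f > 1/2], hence [e = 1]; both functions vanish off [V] and [W], and
   [k z = 1]. *)
pose e y := Order.min (2 * f y) 1.
pose k y := Order.max (2 * f y - 1) 0.
have f2c : continuous (fun y => 2 * f y).
  by move=> y; apply: (@continuousM R S (cst 2) f); [exact: cvg_cst|exact: fc].
have ec : continuous e.
  by move=> y; apply: (@continuous_min R S (fun y => 2 * f y) (cst 1));
     [exact: f2c|exact: cvg_cst].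
have kc : continuous k.
  move=> y; apply: (@continuous_max R S (fun y => 2 * f y - 1) (cst 0));
    last exact: cvg_cst.
  apply: (@continuousB R R^o S (fun y => 2 * f y) (cst 1)); [exact: f2c|exact: cvg_cst].
(* On [W] this is the inverse of the modulus of [a 0], so multiplying the conjugate of [a 0] by its
   square inverts [a 0] there; everywhere the result is at most [2 / c]. *)
pose psi y := (Order.max (normc (a 0 y)) (c / 2))^-1.
have psic : continuous psi.
  by apply: continuous_divmax c2 _; apply: continuous_normc; exact: ell1_continuous.
have psi2c : continuous (fun y => psi y * psi y).
  by move=> y; apply: (@continuousM R S psi psi); exact: psic.
have uc := continuous_mulc (continuous_conjc (@ell1_continuous R S a 0))
  (continuous_realc psi2c).
have m0 y : 0 < Order.max (normc (a 0 y)) (c / 2) by rewrite lt_max c2 orbT.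
have psi0 y : 0 < psi y by rewrite invr_gt0.
have u_le y : normc ((a 0 y)^* * (psi y * psi y)%:C) <= 2 / c.
  rewrite normcM normc_conj normc_real ger0_norm ?mulr_ge0 ?(ltW (psi0 y))//.
  have le1 : normc (a 0 y) * psi y <= 1.
    by rewrite /psi ler_pdivrMr ?m0// mul1r le_max lexx.
  have le2 : psi y <= 2 / c.
    rewrite /psi -[2 / c]invf_div lef_pV2 ?posrE//.
    by rewrite le_max lexx orbT.
  rewrite mulrA; have := psi0 y; nra.
have u1 y : W y -> (a 0 y)^* * (psi y * psi y)%:C * a 0 y = 1.
  move=> Wy; rewrite mulrAC mul_conjc -rmorphM/= /psi.
  rewrite (max_idPl _) ?(ltW Wy)//.
  have ay : normc (a 0 y) != 0 by rewrite gt_eqF// (lt_trans _ Wy).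
  by rewrite -invfM -expr2 divff// expf_neq0.
pose u := mono 0 uc; pose b := u * a.
have bE n y : b n y = (a 0 y)^* * (psi y * psi y)%:C * a n y.
  by rewrite /b mono_mulE subr0.
pose E := mono 0 (continuous_realc ec); pose K := mono 0 (continuous_realc kc).
have wE : K * (E * b * E) = K * (1 + tail A b * E).
  apply: ell1P => n y; rewrite [LHS]mono_mulE [RHS]mono_mulE subr0 sigz0.
  have [ky|ky] := eqVneq (k y) 0; first by rewrite ky !mul0r.
  have fy : 1 / 2 < f y.
    rewrite ltNge; apply/negP => fy; move/eqP: ky; apply.
    by rewrite /k; apply/max_idPr; lra.
  have ey : e y = 1 by rewrite /e; apply/min_idPr; lra.
  have VWy : (V `&` W) y.
    by apply/not_notP => /fVW fy0; move: fy; rewrite fy0; lra.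
  congr (_ * _); rewrite mul_monoE subr0 mono_mulE subr0 sigz0 ey mul1r.
  transitivity ((1 : ell1) n y + (tail A b * E) n y); last by [].
  rewrite [X in _ + X]mul_monoE subr0 tailE.
  have -> : (1 : ell1) n y = if n == 0 then 1 else 0 by [].
  case: (eqVneq n 0) => [->|n0].
    by rewrite A0in mul0r addr0 ey mulr1 bE u1//; case: VWy.
  rewrite add0r; case: ifPn => [nA|//]; rewrite mul0r.
  (* The index [n] is a nonzero element of [A], so [V] excludes that [y] and its translate both lie
     in it. *)
  suff -> : e (sigz n y) = 0 by rewrite mulr0.
  have -> : e (sigz n y) = Order.min (2 * 0) 1.
    rewrite /e fVW// => -[Vny _]; case: VWy => Vy _.
    by apply: (VV n y) => //; rewrite mem_filter n0.
  by rewrite mulr0; apply/min_idPl.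
have t1 : nrm1 (- (tail A b * E)) < 1.
  have -> : tail A b = u * tail A a.
    apply: ell1P => n y; rewrite [LHS]tailE [RHS]mono_mulE subr0 sigz0 bE. rewrite tailE.
    by case: ifP => _; rewrite ?mulr0.
  have Ele : nrm1 E <= 1.
    apply: nrm1_mono => y; rewrite normc_real.
    have /andP[fy0 fy1] := f01 y.
    have ey0 : 0 <= e y by rewrite /e le_min ler01 mulr_ge0.
    by rewrite ger0_norm// /e ge_min lexx orbT.
  have ule : nrm1 u <= 2 / c by apply: nrm1_mono.
  apply: (le_lt_trans (nrm1N _)); apply: (le_lt_trans (nrm1M _ _)).
  have h1 : nrm1 (u * tail A a) <= 2 / c * (c / 4).
    by apply: (le_trans (nrm1M _ _)); rewrite ler_pM ?nrm1_ge0.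
  have h2 : 2 / c * (c / 4) = 1 / 2 :> R by field; rewrite gt_eqF.
  have : nrm1 (u * tail A a) * nrm1 E <= 1 / 2 * 1.
    by rewrite -h2 ler_pM ?nrm1_ge0.
  lra.
have [y [/= Ey _]] := neumann t1.
rewrite opprK in Ey.
(* Right multiplication by the inverse of [1 + tail A b * E] recovers [K] from an element of the
   ideal. *)
have PK : P K.
  rewrite -[K]mulr1 -Ey mulrA -wE.
  exact: (Pr _ _ (Pl _ _ (Pr _ _ (Pl _ _ (Pl _ _ Pa))))).
have := Pz _ _ PK; rewrite /k fz mulr1.
rewrite (max_idPl _); last by lra.
by move=> /(congr1 (@complex.Re R))/=; lra.
Qed.

Lemma ideal_vanishes a n x : P a -> hull P x -> a n x = 0.
Proof.
have [_ _ _ Pr] := idP.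
move=> Pa Px; have := ideal_coef0_vanishes (Pr _ (delta R S (- n)) Pa) Px.
by rewrite mul_deltaE sub0r opprK.
Qed.

End FreePoints.

(** * Eigenvalues of central elements *)

Section RootsOfUnity.

(** [X^n - 1] splits and is separable in characteristic zero, and [n] distinct roots of it must
    include a primitive one. *)
Lemma prim_root_exists (F : numClosedFieldType) n :
  (0 < n)%N -> exists z : F, n.-primitive_root z.
Proof.
move=> n0; have [r Dr] := closed_field_poly_normal ('X^n - 1 : {poly F}).
rewrite (monicP (monicXnsubC 1 n0)) scale1r in Dr.
suff /hasP[z _ zn] : has n.-primitive_root r by exists z.
apply: has_prim_root => //.
- by apply/allP => z; rewrite -root_prod_XsubC -Dr.
- by rewrite -separable_prod_XsubC -Dr separable_Xn_sub_1// pnatr_eq0 -lt0n.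
- by rewrite -ltnS -(size_prod_XsubC r id) -Dr size_XnsubC.
Qed.

(** Multiplied by the nonzero number [z ^+ j - 1], the geometric sum becomes
    [(z ^+ j) ^+ n - 1 = 0]. *)
Lemma sum_prim_root (F : fieldType) n (z : F) j : n.-primitive_root z ->
  (0 < j < n)%N -> \sum_(k < n) (z ^+ k) ^+ j = 0.
Proof.
move=> zn /andP[j0 jn].
have zj : z ^+ j - 1 != 0.
  rewrite subr_eq0 -(prim_order_dvd zn) gtnNdvd//.
apply: (mulfI zj); rewrite mulr0.
transitivity ((z ^+ j) ^+ n - 1).
  rewrite [RHS]subrX1; congr (_ * _); apply: eq_bigr => k _.
  by rewrite -!exprM mulnC.
by rewrite exprAC (prim_expr_order zn) expr1n subrr.
Qed.

End RootsOfUnity.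

(** * Algebraically irreducible representations *)

Section Irreducible.
Context (K : fieldType) (A : algType K) (E : lmodType K) (pi : representation A E).
Hypothesis irr : alg_irreducible pi.

Lemma reprD a b v : pi (a + b) v = pi a v + pi b v.
Proof. by have := repr_linear pi v 1 a b; rewrite !scale1r. Qed.

Lemma repr0 v : pi 0 v = 0.
Proof. by have := reprD 0 0 v; rewrite addr0 => /eqP; rewrite addrC -subr_eq subrr => /eqP. Qed.

Lemma reprZ z a v : pi (z *: a) v = z *: pi a v.
Proof. by have := repr_linear pi v z a 0; rewrite addr0 repr0 addr0. Qed.

Lemma reprN a v : pi (- a) v = - pi a v.
Proof. by rewrite -[- a]scaleN1r reprZ scaleN1r. Qed.

Lemma reprB a b v : pi (a - b) v = pi a v - pi b v.
Proof. by rewrite reprD reprN. Qed.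

Lemma irreducible_nontrivial : exists v : E, v != 0.
Proof. by case: irr => -[a [v av]] _; exists (pi a v). Qed.

(** The orbit of [v] is invariant. Were it zero, [v] would lie in the invariant subspace of vectors
    killed by the whole algebra, which is zero because the action is not. *)
Lemma irreducible_cyclic v w : v != 0 -> exists a, pi a v = w.
Proof.
move=> v0; have [_ irrW] := irr.
have [||H] := irrW [set u | exists a, pi a v = u].
- split; first split.
  + by exists 0; exact: repr0.
  + move=> z _ _ [a <-] [b <-]; exists (z *: a + b); exact: repr_linear.
  + by move=> a _ [b <-]; exists (a * b); exact: repr_mul.
- move=> H; have av a : pi a v = 0.
    have : [set u | exists a, pi a v = u] (pi a v) by exists a.
    by rewrite H.
  have [||H0] := irrW [set u | forall a, pi a u = 0].
  + split; first split.
    * by move=> a; rewrite linear0.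
    * by move=> z u u' /= Hu Hu' a; rewrite linearP Hu Hu' scaler0 addr0.
    * by move=> a u /= Hu b; rewrite -repr_mul Hu.
  + move=> H0; have : [set u | forall a, pi a u = 0] v by [].
    by rewrite H0 => /eqP; rewrite (negPf v0).
  + have [[a [u /eqP au]] _] := irr; case: au.
    have : [set: E] u by [].
    by rewrite -H0; exact.
- have : [set: E] w by [].
  by rewrite -H.
Qed.

Lemma irreducible_repr1 v : pi 1 v = v.
Proof.
have [u u0] := irreducible_nontrivial.
by have [a <-] := irreducible_cyclic v u0; rewrite -repr_mul mul1r.
Qed.

(** If [b] does not kill [v], every vector has the form [c b v] by cyclicity, and [a] kills it. *)
Lemma irreducible_prime a b :
  (forall c, repr_kernel pi (a * c * b)) -> repr_kernel pi a \/ repr_kernel pi b.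
Proof.
move=> acb; have [|/existsNP[v /eqP bv]] := pselect (repr_kernel pi b); first by right.
left=> w; have [c <-] := irreducible_cyclic w bv.
by rewrite -!repr_mul acb.
Qed.

(** The kernel and the image of [T] are invariant subspaces. *)
Lemma schur (T : E -> E) : linear T -> (forall a v, T (pi a v) = pi a (T v)) ->
  (exists v, T v <> 0) -> (forall v, T v = 0 -> v = 0) /\ (forall w, exists v, T v = w).
Proof.
move=> Tl Tc [v0 Tv0]; have [_ irrW] := irr.
have T0 : T 0 = 0.
  by have := Tl (-1) 0 0; rewrite scaler0 addr0 scaleN1r addNr.
split.
- have [||H] := irrW [set u | T u = 0].
  + split; first by split=> // z u w /= Tu Tw; rewrite Tl Tu Tw scaler0 addr0.
    by move=> a u /= Tu; rewrite Tc Tu linear0.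
  + by move=> H u Tu; have : [set u | T u = 0] u by []; rewrite H.
  + by case: Tv0; have : [set: E] v0 by []; rewrite -H.
- have [||H] := irrW [set w | exists u, T u = w].
  + split; first split.
    * by exists 0.
    * by move=> z _ _ [u <-] [w <-]; exists (z *: u + w); exact: Tl.
    * by move=> a _ [u <-]; exists (pi a u); exact: Tc.
  + move=> H; case: Tv0; have : [set w | exists u, T u = w] (T v0) by exists v0.
    by rewrite H.
  + by move=> w; have : [set: E] w by []; rewrite -H.
Qed.

End Irreducible.

Section LocallyBounded.
Context (R : realType).
Local Notation C := R[i].

Lemma normc_le_ReIm (z : C) : normc z <= `|complex.Re z| + `|complex.Im z|.
Proof.
case: z => a b /=.
have -> : `|a| + `|b| = Num.sqrt ((`|a| + `|b|) ^+ 2).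
  by rewrite sqrtr_sqr [RHS]ger0_norm ?addr_ge0.
rewrite ler_wsqrtr// sqrrD !real_normK ?num_real// addrAC.
by rewrite lerDl mulrn_wge0// mulr_ge0.
Qed.

(** The disc lies in a compact square, which finitely many small squares cover; half the local
    radius as half-side keeps each within its disc. Summing the absolute values of the local bounds
    gives a common one. *)
Lemma locally_bounded_disc (h : C -> R) (r : R) :
  (forall z, exists d M : R, 0 < d /\ forall w, normc (w - z) < d -> h w <= M) ->
  exists M : R, forall z, normc z <= r -> h z <= M.
Proof.
move=> hloc.
have /choice[dM HdM] (p : R * R) : exists dM : R * R, 0 < dM.1 /\
    forall w, normc (w - (p.1 +i* p.2)) < dM.1 -> h w <= dM.2.
  by have [d [M [d0 H]]] := hloc (p.1 +i* p.2); exists (d, M).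
pose U (p : R * R) : set (R * R) :=
  (fst @^-1` ball p.1 ((dM p).1 / 2)) `&` (snd @^-1` ball p.2 ((dM p).1 / 2)).
pose K : set (R * R) := `[(- r), r]%classic `*` `[(- r), r]%classic.
have Kc : compact K by apply: compact_setX; exact: segment_compact.
have [p|p|D DK] := @finite_neighbourhood_cover _ K U Kc.
- by apply: openI; apply: open_comp; (try exact: ball_open) => x _;
     [exact: cvg_fst|exact: cvg_snd].
- by have [d0 _] := HdM p; split; apply: ballxx; rewrite divr_gt0.
exists (\sum_(p <- D) `|(dM p).2|) => z zr.
have [Rez Imz] := normc_ge_ReIm z.
have Kz : K (complex.Re z, complex.Im z).
  by split; rewrite /= in_itv/= -ler_norml; exact: le_trans zr.
have [p pD [/= Up1 Up2]] := DK _ Kz.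
have [d0 Hp] := HdM p.
apply: (@le_trans _ _ (dM p).2).
  apply: Hp; apply: (le_lt_trans (normc_le_ReIm _)).
  move: Up1 Up2; rewrite -!ball_normE/= => Up1 Up2.
  rewrite [ltRHS]splitr; apply: ltrD.
    by rewrite distrC in Up1; move: Up1; case: (z).
  by rewrite distrC in Up2; move: Up2; case: (z).
apply: (le_trans (ler_norm _)); rewrite (big_fsetD1 p)//= lerDl.
by apply: sumr_ge0 => q _.
Qed.

End LocallyBounded.

(** * Irreducible representations of a normed algebra with Neumann inverses *)

Section NormedIrreducible.
Context (R : realType).
Local Notation C := R[i].
Context (A : algType C) (N : A -> R).
Context (N_ge0 : forall a, 0 <= N a).
Context (ND : forall a b, N (a + b) <= N a + N b).
Context (NZ : forall z a, N (z *: a) <= normc z * N a).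
Context (NM : forall a b, N (a * b) <= N a * N b).
Context (N1 : N 1 <= 1).
Context (Nneumann : forall a, N a < 1 -> exists y, y * (1 - a) = 1).
Context (E : lmodType C) (pi : representation A E) (irr : alg_irreducible pi).

Let pi1 := irreducible_repr1 irr.

(** [1 - a] kills [v] and has a left inverse. *)
Lemma near_fixed_eq0 a v : N a < 1 -> pi a v = v -> v = 0.
Proof.
move=> /Nneumann[y ya] av.
by rewrite -(pi1 v) -ya repr_mul reprB pi1 av subrr linear0.
Qed.

(** If [a v] is nonzero, some [b] sends it back to [v]. For [p] in the kernel close to [a], the
    element [b * (a - p)] has norm below 1 and fixes [v]. *)
Lemma repr_kernel_closed a :
  (forall e : R, 0 < e -> exists2 p, repr_kernel pi p & N (a - p) <= e) ->
  repr_kernel pi a.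
Proof.
move=> ap v; apply/eqP/negPn/negP => av.
have [b bav] := irreducible_cyclic irr v av.
have b0 : 0 < N b + 1 by rewrite ltr_wpDl.
have e0 : 0 < (N b + 1)^-1 by rewrite invr_gt0.
have [p Pp Np] := ap _ e0.
have v0 : v = 0.
  apply: (@near_fixed_eq0 (b * (a - p))).
    apply: (le_lt_trans (NM _ _)).
    apply: (@le_lt_trans _ _ (N b / (N b + 1))); first by rewrite ler_wpM2l.
    by rewrite ltr_pdivrMr// mul1r ltrDl.
  by rewrite repr_mul reprB Pp subr0.
by rewrite v0 linear0 eqxx in av.
Qed.

Section Eigenvalue.
Context (v : E) (v0 : v != 0).

(* The norm of the quotient of [A] by the annihilator of [v], carried over to
   [E] by [a |-> pi a v]. *)
Definition quot_norm (w : E) : R := inf [set N a | a in [set a | pi a v = w]].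

Local Notation q := quot_norm.

Lemma quot_norm_has_inf w : has_inf [set N a | a in [set a | pi a v = w]].
Proof.
split; first by have [a aw] := irreducible_cyclic irr w v0; exists (N a), a.
by exists 0 => _ [a _ <-].
Qed.

Lemma quot_norm_le a : q (pi a v) <= N a.
Proof. by apply: ge_inf; [have [] := quot_norm_has_inf (pi a v)|exists a]. Qed.

Lemma quot_norm_ge0 w : 0 <= q w.
Proof.
have [Hne _] := quot_norm_has_inf w.
by apply: lb_le_inf => // _ [a _ <-].
Qed.

Lemma quot_norm_approx w (e : R) : 0 < e -> exists2 a, pi a v = w & N a < q w + e.
Proof.
move=> e0; have [_ [a aw <-] ae] := inf_adherent e0 (quot_norm_has_inf w).
by exists a.
Qed.

Lemma quot_normD u w : q (u + w) <= q u + q w.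
Proof.
apply/ler_addgt0Pr => e e0; have e20 : 0 < e / 2 by rewrite divr_gt0.
have [a <- ae] := quot_norm_approx u e20; have [b <- be] := quot_norm_approx w e20.
rewrite -reprD; apply: (le_trans (quot_norm_le _)); apply: (le_trans (ND _ _)).
by rewrite [in leRHS](splitr e) addrACA lerD ?ltW// (lt_le_trans ae, lt_le_trans be).
Qed.

(** A bound in terms of every representative passes to the infimum; the slack [e / (t + 1)] absorbs
    the factor [t]. *)
Lemma quot_norm_op (T : E -> E) (t : R) w : 0 <= t ->
  (forall a, q (T (pi a v)) <= t * N a) -> q (T w) <= t * q w.
Proof.
move=> t0 Tt; apply/ler_addgt0Pr => e e0.
have t1 : 0 < t + 1 by rewrite ltr_wpDl.
have [a aw ae] := quot_norm_approx w (divr_gt0 e0 t1).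
rewrite -{1}aw; apply: (le_trans (Tt a)).
apply: (le_trans (ler_wpM2l t0 (ltW ae))).
rewrite mulrDr lerD2l mulrA ler_pdivrMr// mulrC.
by rewrite ler_wpM2l ?ltW// ltrDl.
Qed.

Lemma quot_normZ z w : q (z *: w) <= normc z * q w.
Proof.
apply: (quot_norm_op (T := fun w => z *: w)); first exact: normc_ge0.
by move=> a; rewrite -reprZ; apply: (le_trans (quot_norm_le _)).
Qed.

Lemma quot_normM a w : q (pi a w) <= N a * q w.
Proof.
apply: (quot_norm_op (T := pi a)) => // b.
by rewrite -repr_mul; apply: (le_trans (quot_norm_le _)).
Qed.

(** A map commuting with the action is determined by its value at the cyclic vector, since
    [G (a v) = a (G v)]. *)
Lemma quot_norm_comm (G : E -> E) w : (forall a u, G (pi a u) = pi a (G u)) ->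
  q (G w) <= q (G v) * q w.
Proof.
move=> Gc; apply: quot_norm_op; first exact: quot_norm_ge0.
by move=> a; rewrite Gc mulrC quot_normM.
Qed.

(** Some [b] sends a nonzero [w] to [v]; a representative [a] of [w] of small norm would make
    [b * a] fix [v] with norm below 1. *)
Lemma quot_norm_eq0 w : q w <= 0 -> w = 0.
Proof.
move=> qw; apply/eqP/negPn/negP => w0.
have [b bw] := irreducible_cyclic irr v w0.
have b0 : 0 < N b + 1 by rewrite ltr_wpDl.
have e0 : 0 < (N b + 1)^-1 by rewrite invr_gt0.
have [a aw ae] := quot_norm_approx w e0.
suff : v = 0 by apply/eqP.
apply: (@near_fixed_eq0 (b * a)); last by rewrite repr_mul aw.
apply: (le_lt_trans (NM _ _)).
apply: (@le_lt_trans _ _ (N b / (N b + 1))).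
  by rewrite ler_wpM2l// (le_trans (ltW ae))// gerDr.
by rewrite ltr_pdivrMr// mul1r ltrDl.
Qed.

Lemma quot_normN w : q (- w) <= q w.
Proof. by have := quot_normZ (-1) w; rewrite scaleN1r normcN normc1 mul1r. Qed.

Lemma quot_norm_gt0 w : w != 0 -> 0 < q w.
Proof. by move=> w0; rewrite ltNge; apply: contra w0 => /quot_norm_eq0 ->. Qed.

Lemma quot_norm_sum n (F : 'I_n -> E) (M : R) :
  (forall k, q (F k) <= M) -> q (\sum_(k < n) F k) <= n%:R * M.
Proof.
move=> FM; elim: n F FM => [|n IH] F FM.
  rewrite big_ord0 mul0r -(scale0r v); apply: (le_trans (quot_normZ _ _)).
  by rewrite normc0 mul0r.
rewrite big_ord_recr/=; apply: (le_trans (quot_normD _ _)).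
by rewrite -natr1 mulrDl mul1r lerD ?IH.
Qed.

Lemma quot_norm_contraction a w : N a <= 1 -> q (pi a w) <= q w.
Proof.
move=> Na; apply: (le_trans (quot_normM _ _)).
by rewrite ler_piMl// quot_norm_ge0.
Qed.

Lemma contractionX a n : N a <= 1 -> N (a ^+ n) <= 1.
Proof.
move=> Na; elim: n => [|n IH]; first by rewrite expr0.
by rewrite exprS (le_trans (NM _ _))// mulr_ile1.
Qed.

Context (d d' : A) (d'd : d' * d = 1) (Nd : N d <= 1) (Nd' : N d' <= 1).
Context (d_central : forall a w, pi d (pi a w) = pi a (pi d w)).

Let T := pi d.

Lemma inverse_pow n w : pi (d' ^+ n) (pi (d ^+ n) w) = w.
Proof.
rewrite -repr_mul; suff -> : d' ^+ n * d ^+ n = 1 by rewrite pi1.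
elim: n => [|n IH]; first by rewrite !expr0 mulr1.
by rewrite exprSr exprS -mulrA (mulrA d') d'd mul1r.
Qed.

(** * The resolvent of an operator assumed not to be a scalar *)

Section Resolvent.
Context (noeigen : forall l : C, exists w, T w <> l *: w).

Let theta (z : C) (w : E) := w - z *: T w.

Lemma thetaL z : linear (theta z).
Proof.
move=> c u w; rewrite /theta /T linearP scalerDr !scalerA (mulrC z c) -!scalerA.
by rewrite scalerBr opprD addrACA.
Qed.

Lemma theta_comm z a w : theta z (pi a w) = pi a (theta z w).
Proof. by rewrite /theta /T [RHS]linearB/= [in RHS]linearZ/= d_central. Qed.

Lemma theta0 z : theta z 0 = 0.
Proof. by rewrite /theta /T linear0 scaler0 subrr. Qed.

Lemma thetaD z u w : theta z (u + w) = theta z u + theta z w.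
Proof. by have := thetaL z 1 u w; rewrite !scale1r. Qed.

Lemma thetaZ z c u : theta z (c *: u) = c *: theta z u.
Proof. by have := thetaL z c u 0; rewrite theta0 !addr0. Qed.

Lemma thetaB z u w : theta z (u - w) = theta z u - theta z w.
Proof. by rewrite thetaD -scaleN1r thetaZ scaleN1r. Qed.

(** By Schur's lemma it is enough that [theta z] is nonzero: it is the identity for [z = 0], and
    otherwise [T] is not the scalar [z^-1]. *)
Lemma theta_bij z :
  (forall w, theta z w = 0 -> w = 0) /\ (forall w, exists u, theta z u = w).
Proof.
apply: (schur irr (thetaL z)) => [a w|]; first exact: theta_comm.
have [->|z0] := eqVneq z 0.
  by exists v; rewrite /theta scale0r subr0; exact/eqP.
have [w Tw] := noeigen z^-1; exists w => /subr0_eq wz; apply: Tw.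
by rewrite {2}wz scalerA mulVf// scale1r.
Qed.

Lemma theta_inj z u w : theta z u = theta z w -> u = w.
Proof.
move=> uw; apply/subr0_eq; have [+ _] := theta_bij z; apply.
by rewrite thetaB uw subrr.
Qed.

Let ex_resolvent : exists G : C -> E -> E, forall z w, theta z (G z w) = w.
Proof.
have H z : exists g : E -> E, forall w, theta z (g w) = w.
  by have [_ Hs] := theta_bij z; have [g Hg] := choice Hs; exists g.
by have [g Hg] := choice H; exists g.
Qed.

Let G := projT1 (cid ex_resolvent).
Let thetaG z w : theta z (G z w) = w := projT2 (cid ex_resolvent) z w.

Lemma resolvent_comm z a w : G z (pi a w) = pi a (G z w).
Proof. by apply: (@theta_inj z); rewrite theta_comm !thetaG. Qed.

(** The resolvent identity, checked after applying the injective map [theta z]. *)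
Lemma resolvent_id z y w : G z w - G y w = (z - y) *: T (G z (G y w)).
Proof.
apply: (@theta_inj z).
rewrite thetaB thetaZ /T theta_comm !thetaG -/T.
have -> : theta z (G y w) = theta y (G y w) - (z - y) *: T (G y w).
  by rewrite /theta scalerBl opprB addrA subrK.
by rewrite thetaG opprB addrC subrK.
Qed.

Lemma resolvent_diff z y :
  q (G z v - G y v) <= normc (z - y) * (q (G z v) * q (G y v)).
Proof.
rewrite resolvent_id; apply: (le_trans (quot_normZ _ _)).
rewrite ler_wpM2l ?normc_ge0//; apply: (le_trans (quot_norm_contraction _ Nd)).
by apply: quot_norm_comm => a u; exact: resolvent_comm.
Qed.

Lemma resolvent_bounded (r : R) :
  exists M : R, forall z, normc z <= r -> q (G z v) <= M.
Proof.
apply: locally_bounded_disc => z.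
have g0 : 0 < q (G z v) + 1 by rewrite ltr_wpDl ?quot_norm_ge0.
(* Within this radius [resolvent_diff] bounds the increment by half of [q (G w v)], which is then
   absorbed on the left and leaves the factor 2. *)
exists ((q (G z v) + 1)^-1 / 2), (2 * q (G z v)); split.
  by rewrite divr_gt0 ?invr_gt0.
move=> w wz.
have h1 : q (G w v) <= q (G z v) + q (G w v - G z v).
  by rewrite -{1}(subrK (G z v) (G w v)) addrC quot_normD.
have h2 := resolvent_diff w z.
have h3 : normc (w - z) * q (G z v) <= 1 / 2.
  apply: (@le_trans _ _ ((q (G z v) + 1)^-1 / 2 * (q (G z v) + 1))).
    by rewrite ler_pM ?normc_ge0 ?quot_norm_ge0 ?(ltW wz)// lerDl.
  by rewrite mulrAC mulVf ?gt_eqF.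
have := ler_wpM2l (quot_norm_ge0 (G w v)) h3.
have -> : q (G w v) * (normc (w - z) * q (G z v)) =
  normc (w - z) * (q (G w v) * q (G z v)) by ring.
lra.
Qed.

Lemma theta_geometric z n w :
  theta z (\sum_(j < n) z ^+ j *: pi (d ^+ j) w) = w - z ^+ n *: pi (d ^+ n) w.
Proof.
elim: n => [|n IH].
  by rewrite big_ord0 theta0 !expr0 scale1r pi1 subrr.
rewrite big_ord_recr/= thetaD IH /theta /T [pi d (_ *: _)]linearZ/= scalerA -exprS.
by rewrite -repr_mul -exprS addrA subrK.
Qed.

(** Writing [v] as [theta z (G z v)] reduces this to the geometric identity at [G z v]. *)
Lemma resolvent_pow z n :
  G z v - z ^+ n *: pi (d ^+ n) (G z v) = \sum_(j < n) z ^+ j *: pi (d ^+ j) v.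
Proof.
rewrite -theta_geometric; elim: n => [|n IH]; first by rewrite !big_ord0 theta0.
by rewrite !big_ord_recr/= thetaD IH thetaZ theta_comm thetaG.
Qed.

(* Over the n-th roots of unity the terms [z ^ j T ^ j] with 0 < j < n of the
   geometric sums cancel, so this is (1 - r^n T^n)^-1 v. *)
Definition resolvent_average n (z : C) (r : R) : E :=
  n%:R^-1 *: \sum_(k < n) G (r%:C * z ^+ k) v.

Lemma resolvent_averageE n z (r : R) : (0 < n)%N -> n.-primitive_root z ->
  resolvent_average n z r -
    (r ^+ n)%:C *: pi (d ^+ n) (resolvent_average n z r) = v.
Proof.
move=> n0 zn; have nC0 : n%:R != 0 :> C by rewrite pnatr_eq0 -lt0n.
rewrite /resolvent_average [pi _ (n%:R^-1 *: _)]linearZ/= [pi _ (\sum_(k < n) _)]linear_sum/=.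
rewrite scalerA [_ * _^-1]mulrC -scalerA -scalerBr scaler_sumr -sumrB.
apply: (scalerI nC0); rewrite scalerA mulfV// scale1r.
transitivity (\sum_(k < n) \sum_(j < n)
    ((r ^+ j)%:C * (z ^+ k) ^+ j) *: pi (d ^+ j) v).
  apply: eq_bigr => k _.
  have <- : (r%:C * z ^+ k) ^+ n = (r ^+ n)%:C.
    by rewrite exprMn -exprM mulnC exprM (prim_expr_order zn) expr1n mulr1 rmorphXn.
  rewrite resolvent_pow; apply: eq_bigr => j _.
  by rewrite exprMn rmorphXn.
rewrite exchange_big/=.
transitivity (\sum_(j < n) ((r ^+ j)%:C * \sum_(k < n) (z ^+ k) ^+ j) *: pi (d ^+ j) v).
  by apply: eq_bigr => j _; rewrite mulr_sumr scaler_suml.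
case: n n0 zn nC0 => // n _ zn _.
rewrite big_ord_recl/= [X in _ + X]big1 ?addr0; last first.
  by move=> j _; rewrite (sum_prim_root zn) ?mulr0 ?scale0r//= ltnS.
rewrite !expr0 pi1 mul1r; congr (_ *: _).
under eq_bigr do rewrite expr0.
by rewrite sumr_const card_ord.
Qed.

(* As n grows, the averages tend to v for r < 1 and to 0 for r > 1, while
   they are Lipschitz in r uniformly in n. *)
Lemma resolvent_contradiction : False.
Proof.
have [M0 HM0] := resolvent_bounded 2.
pose M := Order.max M0 0.
have HM z : normc z <= 2 -> q (G z v) <= M.
  by move=> /HM0 H; rewrite (le_trans H)// le_max lexx.
have M_ge0 : 0 <= M by rewrite le_max lexx orbT.
have c0 := quot_norm_gt0 v0; set c := q v in c0.
have K0 : 0 < 16 * (M * M + 1) by nra.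
(* The bound [1 / 2] keeps [r = 1 - h] and [s = 1 / r] in the disc of radius 2 and gives
   [s - r <= 4 * h]; the other bound makes the Lipschitz estimate between [r] and [s] at most
   [c / 4]. *)
pose h := Order.min (1 / 2) (c / (16 * (M * M + 1))).
have h0 : 0 < h by rewrite lt_min divr_gt0//= divr_gt0.
have h12 : h <= 1 / 2 by rewrite ge_min lexx.
have hM : 4 * h * (M * M) <= c / 4.
  have : h * (16 * (M * M + 1)) <= c by rewrite -ler_pdivlMr// ge_min lexx orbT.
  nra.
pose r := 1 - h; have r0 : 0 < r by rewrite /r; lra.
have r1 : r < 1 by rewrite /r; lra.
pose s := r^-1; have s0 : 0 < s by rewrite invr_gt0.
have rs : r * s = 1 by rewrite /s mulfV// gt_eqF.
have s2 : s <= 2 by rewrite /r in rs; nra.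
have sr : s - r <= 4 * h by rewrite /r in rs *; nra.
have sr0 : 0 <= s - r by rewrite /r in rs *; nra.
(* The errors at [r] and at [s] will be [r ^+ n * M] and [r ^+ n * (M + c)]; [n] makes their sum at
   most [c / 4]. *)
have [n n0 rn] : exists2 n, (0 < n)%N & r ^+ n * (2 * M + c) <= c / 4.
  have L0 : 0 < 2 * M + c by lra.
  have e0 : 0 < c / 4 / (2 * M + c) by rewrite !divr_gt0.
  have rabs : `|r| < 1 by rewrite gtr0_norm.
  have /cvgrPdist_lt/(_ _ e0)[k _ Hk] := sequences.cvg_expr rabs.
  exists k.+1 => //; rewrite -ler_pdivlMr//; apply: ltW.
  have := Hk k.+1 (leqnSn k); rewrite /= sub0r normrN.
  by apply: le_lt_trans; exact: ler_norm.
have [z zn] := @prim_root_exists C n n0.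
have nz k : normc (z ^+ k) = 1.
  have zz : normc (z ^+ k) ^+ n = 1.
    by rewrite -normcX exprAC (prim_expr_order zn) expr1n normc1.
  by apply/eqP; rewrite -(@pexpr_eq1 _ _ n)// ?zz// normc_ge0.
have nr k (t : R) : 0 <= t -> normc (t%:C * z ^+ k) = t.
  by move=> t0; rewrite normcM nz mulr1 normc_real ger0_norm.
have nC0 : 0 < n%:R :> R by rewrite ltr0n.
have normn : normc (n%:R^-1 : C) = n%:R^-1.
  by rewrite normcV -(rmorph_nat (real_complex R)) normc_real ger0_norm ?ltW.
have avg (F : 'I_n -> E) (B : R) : (forall k, q (F k) <= B) ->
    q (n%:R^-1 *: \sum_(k < n) F k) <= B.
  move=> FB; apply: (le_trans (quot_normZ _ _)); rewrite normn.
  by rewrite mulrC ler_pdivrMr// mulrC; exact: quot_norm_sum.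
pose phi := resolvent_average n z.
have phiM t : 0 <= t -> t <= 2 -> q (phi t) <= M.
  by move=> t0 t2; apply: avg => k; apply: HM; rewrite nr.
have phiB : q (phi r - phi s) <= c / 4.
  apply: le_trans hM; rewrite /phi /resolvent_average -scalerBr -sumrB.
  apply: avg => k; apply: (le_trans (resolvent_diff _ _)).
  rewrite ler_pM ?normc_ge0 ?mulr_ge0 ?quot_norm_ge0//.
    rewrite -mulrBl -rmorphB normcM nz mulr1 normc_real distrC.
    by rewrite ger0_norm.
  have rr : r <= 2 by lra.
  by rewrite ler_pM ?quot_norm_ge0// HM ?nr// ltW.
have phi_r : q (v - phi r) <= r ^+ n * M.
  have E1 := resolvent_averageE r n0 zn.
  rewrite -{1}E1 -/(phi r) addrAC subrr add0r.
  apply: (le_trans (quot_normN _)); apply: (le_trans (quot_normZ _ _)).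
  rewrite normc_real ger0_norm ?exprn_ge0 ?(ltW r0)// ler_wpM2l ?exprn_ge0 ?(ltW r0)//.
  apply: le_trans (phiM r (ltW r0) _); last by lra.
  exact/quot_norm_contraction/contractionX.
have phi_s : q (phi s) <= r ^+ n * (M + c).
  have E1 := resolvent_averageE s n0 zn; rewrite -/(phi s) in E1.
  (* The equation at [s] is solved for the image of [phi s] under the n-th power of [T], which the
     contraction [d' ^+ n] then undoes. *)
  have E2 : pi (d ^+ n) (phi s) = (r ^+ n)%:C *: (phi s - v).
    rewrite -[in RHS]E1 opprB addrC subrK scalerA -rmorphM -exprMn rs expr1n.
    by rewrite scale1r.
  rewrite -(inverse_pow n (phi s)) E2.
  apply: (le_trans (quot_norm_contraction _ (contractionX _ Nd'))).
  apply: (le_trans (quot_normZ _ _)).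
  rewrite normc_real ger0_norm ?exprn_ge0 ?(ltW r0)// ler_wpM2l ?exprn_ge0 ?(ltW r0)//.
  apply: (le_trans (quot_normD _ _)); rewrite lerD ?quot_normN//.
  by apply: phiM; rewrite // ltW.
(* The three terms together have norm at most [c / 2], whereas [q v = c > 0]. *)
have vE : v = (v - phi r) + ((phi r - phi s) + phi s) by rewrite subrK subrK.
have := quot_normD (v - phi r) ((phi r - phi s) + phi s); rewrite -vE -/c.
have := quot_normD (phi r - phi s) (phi s).
lra.
Qed.

End Resolvent.

(** The previous contradiction makes [pi d] a scalar [l]. As [d] and its left inverse [d'] both act
    as contractions, [q (l *: v) = q v], which forces modulus 1. *)
Lemma central_eigenvalue_at : exists l : C,
  normc l = 1 /\ forall w, pi d w = l *: w.
Proof.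
have [[l Hl]|] := pselect (exists l : C, forall w, pi d w = l *: w); last first.
  move=> H; exfalso; apply: resolvent_contradiction => l.
  by apply/existsNP => Hl; apply: H; exists l.
exists l; split=> //.
have qv := quot_norm_gt0 v0.
have h1 : q v <= q (l *: v).
  have := quot_norm_contraction (pi d v) Nd'.
  by rewrite -repr_mul d'd pi1 Hl.
have h2 : q (l *: v) <= q v by rewrite -Hl quot_norm_contraction.
have h3 := quot_normZ l v.
have l0 : l != 0.
  apply/eqP => l0; move: h1; rewrite leNgt; apply/negP/negPn.
  by rewrite (le_lt_trans h3)// l0 normc0 mul0r.
have h4 := quot_normZ l^-1 (l *: v).
rewrite scalerA mulVf// scale1r normcV in h4.
have nl : 0 < normc l.
  by rewrite lt_neqAle normc_ge0 andbT eq_sym; apply: contra l0 => /eqP/eq0_normc ->.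
apply/eqP; rewrite eq_le; apply/andP; split.
  rewrite mulrC ler_pdivlMr// in h4.
  by rewrite -(ler_pM2r qv) mul1r mulrC (le_trans h4).
by rewrite -(ler_pM2r qv) mul1r (le_trans h1).
Qed.

End Eigenvalue.

Lemma central_eigenvalue (d d' : A) : d' * d = 1 -> N d <= 1 -> N d' <= 1 ->
  (forall a w, pi d (pi a w) = pi a (pi d w)) ->
  exists l : C, normc l = 1 /\ forall w, pi d w = l *: w.
Proof.
by have [v v0] := irreducible_nontrivial irr; exact: central_eigenvalue_at v0 _ _.
Qed.

End NormedIrreducible.

(** * Primitive ideals *)

Section Periods.
Context (S : dynamical_system).
Implicit Types (x y z : S) (j k m p q : int).

Lemma sigzC j k x : sigz j (sigz k x) = sigz k (sigz j x).
Proof. by rewrite -!sigzD addrC. Qed.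

Lemma sigz_period p q x : sigz p x = x -> sigz (q * p) x = x.
Proof.
move=> px; elim/int_ind: q => [|n IH|n IH]; first by rewrite mul0r.
  by rewrite -addn1 PoszD mulrDl mul1r sigzD px.
rewrite -addn1 PoszD opprD mulrDl mulN1r sigzD.
by rewrite -{1}px sigzNK.
Qed.

Lemma sigz_modz p x m : sigz p x = x -> sigz (m %% p)%Z x = sigz m x.
Proof.
move=> px; have -> : sigz m x = sigz ((m %% p)%Z + (m %/ p)%Z * p) x.
  by rewrite addrC -divz_eq.
by rewrite [RHS]sigzD sigz_period.
Qed.

Lemma modz_mem_iota n p : 0 < p -> (n %% p)%Z \in [seq Posz i | i <- iota 0 `|p|%N].
Proof.
move=> p0; have r0 : 0 <= (n %% p)%Z by rewrite modz_ge0// gt_eqF.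
apply/mapP; exists `|(n %% p)%Z|%N; last by rewrite gez0_abs.
by rewrite mem_iota/= add0n -ltz_nat !gez0_abs ?ltz_pmod// ltW.
Qed.

Lemma sigz_abs k x : sigz k x = x -> sigz `|k|%N x = x.
Proof.
move=> kx; case: (ger0P k) => k0.
  by rewrite gez0_abs.
by rewrite ltz0_abs// -{1}kx sigzNK.
Qed.

(** The remainder of a period modulo the least positive one is again a period, hence zero. *)
Lemma exists_period k x : k != 0 -> sigz k x = x ->
  exists2 p, 0 < p & forall j, sigz j x = x <-> (p %| j)%Z.
Proof.
move=> k0 kx.
pose Q (n : nat) := `[< (0 < n)%N /\ sigz n x = x >].
have exQ : exists n, Q n.
  by exists `|k|%N; apply/asboolP; rewrite absz_gt0 sigz_abs.
case: (ex_minnP exQ) => p /asboolP[p0 px] pmin.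
exists p%:Z => // j; split=> [jx|/dvdzP[q ->]]; last exact: sigz_period.
have r0 : (0 <= (j %% p)%Z) by rewrite modz_ge0// gt_eqF.
have rp : (j %% p)%Z < p by rewrite ltz_pmod.
have rx : sigz (j %% p)%Z x = x by rewrite sigz_modz.
apply/dvdz_mod0P; move: r0 rp rx; case: (j %% p)%Z => // -[//|r] _ rp rx.
have : Q r.+1 by apply/asboolP.
by move=> /pmin; rewrite leqNgt -ltz_nat rp.
Qed.

End Periods.

Section Separation.
Context (R : realType) (S : dynamical_system).

Lemma separate_orbit (s : seq int) (x y : S) : (forall k, k \in s -> sigz k y <> x) ->
  exists V U : set S, [/\ open V, open U, V y, U x &
    forall k z, k \in s -> V z -> U (sigz k z) -> False].
Proof.
elim: s => [|k s IH] sx; first by exists setT, setT; split=> //; exact: openT.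
have [|V [U [Vo Uo Vy Ux VU]]] := IH.
  by move=> j js; apply: sx; rewrite inE js orbT.
have kx : sigz k y <> x by apply: sx; rewrite inE eqxx.
have [A [B [Ao Bo Ay Bx AB]]] := hausdorff_separate kx.
exists (V `&` sigz k @^-1` A), (U `&` B); split=> //.
- by apply: openI => //; exact: open_sigz.
- exact: openI.
move=> j z; rewrite inE => /orP[/eqP ->|js] [Vz /= Az] [Ujz Bjz].
  exact: AB Az Bjz.
exact: VU js Vz Ujz.
Qed.

(** The other points of the orbit are reached by the residues below [p], so they form a finite set
    whose complement is an open neighbourhood of [x]. *)
Lemma bump_at_periodic_point (x : S) (p : int) : 0 < p ->
  (forall j, sigz j x = x <-> (p %| j)%Z) ->
  exists f : S -> R, [/\ continuous f, f x = 1 &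
    forall j, sigz j x <> x -> f (sigz j x) = 0].
Proof.
move=> p0 px.
have px1 : sigz p x = x by apply/px.
pose s := [seq j <- [seq Posz i | i <- iota 0 `|p|%N] | ~~ (p %| j)%Z].
pose V := [set z : S | forall j, j \in s -> z <> sigz j x].
have Vo : open V.
  apply: (@open_forall_seq S int s (fun j => [set z | z <> sigz j x])) => j.
  rewrite (_ : [set z | _] = ~` [set sigz j x]); last by apply/seteqP; split.
  rewrite openC; exact/accessible_closed_set1/hausdorff_accessible/ds_hausdorff.
have Vx : V x.
  by move=> j; rewrite mem_filter => /andP[/negP pj _] jx; apply: pj; exact/px.
have [f [fc fx f01 fV]] := urysohn_point R Vo Vx.
exists f; split=> // j jx; apply: fV => /(_ (j %% p)%Z); rewrite sigz_modz//.
apply=> //; rewrite mem_filter; apply/andP; split.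
  by apply/negP => /px; rewrite sigz_modz.
exact: modz_mem_iota.
Qed.

End Separation.

(** * Kernels of irreducible representations of [ell1] *)

Section Primitive.
Context (R : realType) (S : dynamical_system).
Local Notation C := R[i].
Local Notation ell1 := (ell1 R S).
Implicit Types (a b c : ell1) (f g : S -> C).
Context (E : lmodType C) (pi : representation ell1 E) (irr : alg_irreducible pi).

Local Notation P := (repr_kernel pi).

Lemma repr_kernel_ideal : is_ideal P.
Proof.
split.
- by move=> v; exact: repr0.
- by move=> a b Pa Pb v; rewrite reprD Pa Pb addr0.
- by move=> a b Pb v; rewrite repr_mul Pb linear0.
- by move=> a b Pa v; rewrite repr_mul Pa.
Qed.

Lemma primitive_closed a :
  (forall e : R, 0 < e -> exists2 p, P p & nrm1 (a - p) <= e) -> P a.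
Proof.
apply: repr_kernel_closed irr a.
- exact: nrm1_ge0.
- exact: nrm1M.
- by move=> a /neumann[y [_ ya]]; exists y.
Qed.

Lemma vanishing_primitive a : (forall n x, hull P x -> a n x = 0) -> P a.
Proof.
move=> a0; apply: primitive_closed => e e0.
exact: vanishing_approx repr_kernel_ideal _ _ a0 e0.
Qed.

Lemma primitive_mod_hull a b : (forall n x, hull P x -> a n x = b n x) -> P a -> P b.
Proof.
move=> ab Pa v.
have : P (b - a) by apply: vanishing_primitive => n x Px /=; rewrite ab// subrr.
by move/(_ v); rewrite reprB Pa subr0.
Qed.

Lemma mono_primitive n f (fc : continuous f) x :
  P (mono n fc) -> hull P x -> f x = 0.
Proof.
have [_ _ _ Pr] := repr_kernel_ideal.
move=> Pf Px; apply: (Px f fc); have := Pr _ (delta R S (- n)) Pf.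
congr P; apply: ell1P => m y; rewrite mul_deltaE !monoE opprK.
by have -> : (m + n == n) = (m == 0) by rewrite -subr_eq0 addrK.
Qed.

(** If [x] is off the orbit of [y], bumps [f] near [y] and [g] near [x] can be chosen so that every
    [F * c * G] vanishes on the hull: points of [W] in the hull have at most [|k|] translates.
    Primeness then puts [F] or [G] in the kernel, although both bumps are 1 at a point of the
    hull. *)
Lemma hull_finite_orbit k (W : set S) y : k != 0 -> open W -> W y -> hull P y ->
  (forall z, W z -> hull P z -> sigz k z = z) ->
  forall x, hull P x -> exists j, x = sigz j y.
Proof.
move=> k0 Wo Wy Py Wk x Px; apply: contrapT => xy.
pose s := [seq Posz i | i <- iota 0 `|k|%N].
have [j _ jx|V [U [Vo Uo Vy Ux VU]]] := @separate_orbit S s x y.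
  by apply: xy; exists j.
have [f [fc fy _ fV]] := urysohn_point R (openI Vo Wo) (conj Vy Wy).
have [g [gc gx _ gU]] := urysohn_point R Uo Ux.
pose F := mono 0 (continuous_realc fc); pose G := mono 0 (continuous_realc gc).
have FG c : P (F * c * G).
  apply: vanishing_primitive => n z Pz; rewrite mul_monoE subr0 mono_mulE subr0 sigz0.
  have [[Vz Wz]|/fV ->] := pselect ((V `&` W) z); last by rewrite !mul0r.
  rewrite gU ?mulr0// => Unz.
  have kz := sigz_abs (Wk _ Wz Pz).
  rewrite -(sigz_modz n kz) in Unz; apply: VU _ Vz Unz.
  by have := @modz_mem_iota n `|k|%N; rewrite absz_nat; apply; rewrite ltz_nat absz_gt0.
have [PF|PG] := irreducible_prime irr FG.
  have := mono_primitive PF Py; rewrite fy => /(congr1 (@complex.Re R))/= /eqP.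
  by rewrite oner_eq0.
have := mono_primitive PG Px; rewrite gx => /(congr1 (@complex.Re R))/= /eqP.
by rewrite oner_eq0.
Qed.

(** * The case of a hull that is a single finite orbit *)

Section FiniteOrbit.
Context (p : int) (p_gt0 : 0 < p).
Context (period : forall x j, hull P x -> sigz j x = x <-> (p %| j)%Z).
Context (orbit : forall x y, hull P x -> hull P y -> exists j, y = sigz j x).

(** [sigz p] is the identity on the hull, so the coefficients of the commutator vanish there. *)
Lemma delta_period_central a v : pi (delta R S p) (pi a v) = pi a (pi (delta R S p) v).
Proof.
rewrite -!repr_mul; apply/subr0_eq; rewrite -reprB.
apply: vanishing_primitive => n x Px /=.
rewrite -[X in X - _]/((delta R S p * a) n x) -[X in _ - X]/((a * delta R S p) n x).
rewrite delta_mulE mul_deltaE.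
by have /(period p Px) -> : (p %| p)%Z by []; rewrite subrr.
Qed.

(** [mu] is a [p]-th root of the eigenvalue of [delta p]. Passing to a root gives a weight [mu ^ n]
    for every integer [n], not only for multiples of [p]. *)
Lemma delta_period_root : exists mu : C, normc mu = 1 /\
  forall j v, (p %| j)%Z -> pi (delta R S j) v = mu ^ j *: v.
Proof.
have [||||||||||l [l1 Hl]] := @central_eigenvalue R ell1 (@nrm1 R S) _ _ _ _ _ _ E pi irr
  (delta R S p) (delta R S (- p)).
- exact: nrm1_ge0.
- exact: nrm1D.
- exact: nrm1Z.
- exact: nrm1M.
- exact: nrm1_one.
- by move=> a /neumann[y [_ ya]]; exists y.
- by rewrite -deltaD addNr delta0.
- exact: nrm1_delta.
- exact: nrm1_delta.
- exact: delta_period_central.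
have n0 : (0 < `|p|)%N by rewrite absz_gt0 gt_eqF.
pose mu := (`|p|%N.-root l : C).
have mup : mu ^ p = l.
  have <- : mu ^ Posz `|p|%N = l by exact: rootCK.
  by rewrite gtz0_abs.
have l0 : l != 0.
  by apply/eqP => l0; move: l1; rewrite l0 normc0 => /eqP; rewrite eq_sym oner_eq0.
have mu0 : mu != 0.
  apply: contraNneq l0 => mu0; rewrite -mup mu0.
  by rewrite exp0rz (gt_eqF p_gt0) mulr0z.
exists mu; split.
  apply/eqP; rewrite -(@pexpr_eq1 _ _ `|p|%N)// ?normc_ge0// -normcX.
  by rewrite (rootCK n0 l) l1.
move=> _ v /dvdzP[q ->]; rewrite mulrC -exprz_exp mup.
elim/int_ind: q v => [|n IH|n IH] v.
- by rewrite mulr0 delta0 expr0z scale1r irreducible_repr1.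
- rewrite -addn1 PoszD mulrDr mulr1 deltaD repr_mul Hl linearZ/= IH scalerA.
  by rewrite expfzDr// expr1z mulrC.
- apply: (scalerI l0); rewrite -Hl -repr_mul -deltaD.
  rewrite -addn1 PoszD opprD mulrDr mulrN1 addrCA subrr addr0 IH scalerA.
  by rewrite expfzDr// mulrCA exprN1 mulfV// mulr1.
Qed.

Context (mu : C) (mu1 : normc mu = 1).
Context (mu_delta : forall j v, (p %| j)%Z -> pi (delta R S j) v = mu ^ j *: v).

Lemma root_neq0 : mu != 0.
Proof.
by apply/eqP => mu0; move: mu1; rewrite mu0 normc0 => /eqP; rewrite eq_sym oner_eq0.
Qed.

Lemma normc_root_exp n : normc (mu ^ n) = 1.
Proof.
have H m : normc (mu ^+ m) = 1 by rewrite normcX mu1 expr1n.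
by case: n => m; [exact: H|rewrite NegzE -exprnN normcV H invr1].
Qed.

Lemma conj_root_exp n : (mu ^ (- n))^* = mu ^ n.
Proof.
have m0 : mu ^ (- n) != 0 by rewrite expfz_neq0// root_neq0.
apply: (mulIf m0); rewrite mul_conjc normc_root_exp expr1n.
by rewrite -expfzDr ?root_neq0// subrr expr0z.
Qed.

(* [b] is [a] reduced modulo the relation [delta p = mu ^ p]. *)
Lemma exists_reduction a : exists b,
  [/\ P a <-> P b, forall m x, ~~ (0 <= m < p) -> b m x = 0 &
   forall m x, 0 <= m < p ->
     has_sum (fun n => if (p %| n - m)%Z then mu ^ n * a n x else 0) (mu ^ m * b m x)].
Proof.
have [P0 PD Pl Pr] := repr_kernel_ideal.
pose r n := (n %% p)%Z.
have dr n : (p %| n - r n)%Z by rewrite -eqz_mod_dvd /r modz_mod.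
(* [v n] compares the monomial of [a] at [n] with its reduction at the residue of [n]; the sum of
   all [v n] is in the kernel because the kernel is closed. *)
pose v n := mono n (@ell1_continuous _ _ a n) -
  mu ^ (n - r n) *: mono (r n) (@ell1_continuous _ _ a n).
have Pv n : P (v n).
  move=> w; rewrite reprB reprZ.
  have -> : mono n (@ell1_continuous _ _ a n) =
      mono (r n) (@ell1_continuous _ _ a n) * delta R S (n - r n).
    apply: ell1P => k x; rewrite mul_deltaE !monoE.
    by have -> : (k - (n - r n) == r n) = (k == n) by apply/eqP/eqP => [H|->]; lia.
  by rewrite repr_mul mu_delta// linearZ/= subrr.
have nv n : nrm1 (v n) <= nrm a n + nrm a n.
  have mle k : nrm1 (mono k (@ell1_continuous _ _ a n)) <= nrm a n.
    by apply: nrm1_mono => x; exact: nrm_ge.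
  apply: (le_trans (nrm1D _ _)); apply: lerD => //.
  apply: (le_trans (nrm1N _)); apply: (le_trans (nrm1Z _ _)).
  by rewrite normc_root_exp mul1r.
have vT : sums_le (fun n => nrm1 (v n)) (nrm1 a + nrm1 a).
  apply: sums_le_sub nv _ => A; rewrite big_split lerD//; exact: nrm_sums.
have [y [ys yA]] := ell1_series vT.
have Py : P y.
  apply: primitive_closed => e e0; have [A /(_ A (fsubset_refl _)) HA] := yA e e0.
  exists (\sum_(i <- A) v i) => //.
  by apply: (big_ind P) => //.
exists (a - y).
have bs m x : has_sum (fun n => if m == r n then mu ^ (n - m) * a n x else 0)
    ((a - y) m x).
  have := has_sum_lin (-1) (ys m x) (has_sum1 m (a m x)).
  have -> : -1 * y m x + a m x = (a - y) m x by rewrite mulN1r addrC.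
  congr has_sum; apply/funext => n.
  have -> : v n m x = (if m == n then a n x else 0) -
      mu ^ (n - r n) * (if m == r n then a n x else 0) by [].
  rewrite mulN1r opprB -addrA [n == m]eq_sym.
  have -> : (if m == n then a m x else 0) = if m == n then a n x else 0.
    by case: eqP => [->|].
  rewrite addNr addr0; case: eqP => [->//|_]; exact: mulr0.
split.
- split=> [Pa|Pb] w; first by rewrite reprB Pa Py subr0.
  by have := Pb w; rewrite reprB Py subr0.
- move=> m x mp; apply: has_sum_unique (bs m x) _.
  have := @has_sum0 R int; congr has_sum; apply/funext => n.
  case: eqP => // mr; move: mp; rewrite mr /r modz_ge0 ?gt_eqF// ltz_pmod//.
- move=> m x mp; have := has_sumZ (mu ^ m) (bs m x).
  congr has_sum; apply/funext => n.
  have -> : (p %| n - m)%Z = (m == r n).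
    by rewrite -eqz_mod_dvd (modz_small mp) eq_sym.
  case: eqP => _; last exact: mulr0.
  by rewrite mulrA -expfzDr ?root_neq0// addrC subrK.
Qed.

(** Compress [b] between a bump [e] at [x] and a bump [f] at [sigz m x]. On the hull only the
    coefficient at [m] survives, since indices in [[0, p)] give distinct translates of [x]; its
    value at [x] is [b m x]. *)
Lemma reduced_primitive b : (forall m x, ~~ (0 <= m < p) -> b m x = 0) -> P b ->
  forall m x, hull P x -> b m x = 0.
Proof.
have [_ _ Pl Pr] := repr_kernel_ideal.
move=> b0 Pb m x Px; have [mp|/b0 ->//] := boolP (0 <= m < p).
have hsig k : hull P (sigz k x) by apply: hull_sigz => //; exact: repr_kernel_ideal.
have [e [ec ex e0]] := bump_at_periodic_point R p_gt0 (fun j => period j Px).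
have [f [fc fx f0]] := bump_at_periodic_point R p_gt0 (fun j => period j (hsig m)).
have gc : continuous (fun z => (e z)%:C * b m z * (f (sigz m z))%:C).
  apply: continuous_mulc; first apply: continuous_mulc.
  - exact: continuous_realc.
  - exact: ell1_continuous.
  - apply: continuous_realc => z.
    by apply: continuous_comp; [exact: sigz_continuous|exact: fc].
have Pg : P (mono m gc).
  apply: primitive_mod_hull (Pr _ (mono 0 (continuous_realc fc))
    (Pl (mono 0 (continuous_realc ec)) _ Pb)) => n z Pz.
  rewrite mul_monoE subr0 mono_mulE subr0 sigz0 monoE.
  case: eqP => [->//|nm].
  have [j zj] := orbit Px Pz.
  have [jx|/e0 ez] := pselect (sigz j x = x); last first.
    by rewrite zj ez !mul0r.
  rewrite zj jx.
  have [np|/b0 ->] := boolP (0 <= n < p); last by rewrite mulr0 mul0r.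
  have Enm : sigz n x = sigz (n - m) (sigz m x) by rewrite -sigzD subrK.
  rewrite Enm f0 ?mulr0// => /(period _ (hsig m)).
  rewrite -eqz_mod_dvd !modz_small// => /eqP; exact: nm.
have := mono_primitive Pg Px.
by rewrite ex fx mul1r mulr1.
Qed.

(** This describes the kernel by [mu] and the hull alone. The sums are the coefficients of the
    reduction of [a], up to nonzero factors. *)
Lemma primitive_coefficients a : P a <-> forall m x, hull P x ->
  has_sum (fun n => if (p %| n - m)%Z then mu ^ n * a n x else 0) 0.
Proof.
have [b [Pab b0 bs]] := exists_reduction a.
split=> [/Pab Pb m x Px|H].
  have mp : 0 <= (m %% p)%Z < p by rewrite modz_ge0 ?gt_eqF// ltz_pmod.
  have := bs _ x mp; rewrite (reduced_primitive b0 Pb)// mulr0.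
  congr has_sum; apply/funext => n.
  by rewrite -!eqz_mod_dvd modz_mod.
apply/Pab/vanishing_primitive => m x Px.
have [mp|/b0 ->//] := boolP (0 <= m < p).
have := has_sum_unique (bs m x mp) (H m x Px) => /eqP.
by rewrite mulf_eq0 expfz_eq0 (negPf root_neq0) andbF => /eqP.
Qed.

(** The sum for the adjoint at [m] and [x] is the conjugate of the sum for [a] at [- m] and
    [sigz m x], reindexed by negation: [sigz n x = sigz m x] when [p] divides [n - m]. *)
Lemma star_finite_orbit a : P a -> P (ell1_star a).
Proof.
move=> /primitive_coefficients H; apply/primitive_coefficients => m x Px.
have Py : hull P (sigz m x) by apply: hull_sigz => //; exact: repr_kernel_ideal.
have /has_sum_conj := H (- m) _ Py; rewrite rmorph0.
move=> /(has_sum_bij (h := -%R) (k := -%R) (@opprK _) (@opprK _)).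
congr has_sum; apply/funext => n /=.
have -> : (p %| - n - - m)%Z = (p %| n - m)%Z by rewrite -opprD !dvdzE abszN.
case: ifPn => [nm|_]; last exact: rmorph0.
transitivity (conjc (mu ^ (- n)) * conjc (a (- n) (sigz m x))); first exact: rmorphM.
rewrite conj_root_exp /star alphazE.
have <- : sigz n x = sigz m x; last by [].
have nmx : sigz (n - m) x = x by apply/(period _ Px).
by rewrite -{2}nmx -sigzD addrC subrK.
Qed.

End FiniteOrbit.

Lemma star_primitive a : P a -> P (ell1_star a).
Proof.
have idP := repr_kernel_ideal.
have [moved|] := pselect (forall k, k != 0 -> forall (W : set S) y, open W -> W y ->
  hull P y -> exists z, [/\ W z, hull P z & sigz k z <> z]).
  move=> Pa; apply: vanishing_primitive => n x Px.
  rewrite /= /star alphazE (ideal_vanishes idP moved (- n) Pa) ?conjc0//.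
  exact: hull_sigz.
move=> /existsNP[k /not_implyP[k0 /existsNP[W /existsNP[y]]]].
move=> /not_implyP[Wo /not_implyP[Wy /not_implyP[Py Wk]]].
have kfix z : W z -> hull P z -> sigz k z = z.
  by move=> Wz Pz; apply: contrapT => kz; apply: Wk; exists z.
have orb := hull_finite_orbit k0 Wo Wy Py kfix.
have [p p0 py] := exists_period k0 (kfix _ Wy Py).
have period x j : hull P x -> sigz j x = x <-> (p %| j)%Z.
  move=> /orb[i ->]; rewrite -py sigzC; split=> [H|-> //].
  by rewrite -(sigzNK i (sigz j y)) H sigzNK.
have orbit x z : hull P x -> hull P z -> exists j, z = sigz j x.
  move=> /orb[i ->] /orb[j ->]; exists (j - i).
  by rewrite -sigzD subrK.
have [mu [mu1 mud]] := delta_period_root p0 period.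
exact: star_finite_orbit p0 period orbit mu mu1 mud _.
Qed.

End Primitive.

Theorem theorem4p3 (R : realType) (S : dynamical_system) (J : set (ell1 R S))
    (HJ : primitive_ideal J) :
  selfadjoint J.
Proof.
case: HJ => E [pi [irr ->]]; apply/seteqP; split=> [_ [a Pa <-]|a Pa].
  exact: star_primitive.
by exists (ell1_star a); [exact: star_primitive|exact: ell1_starK].
Qed.
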